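(* Let $a,b,c,d,x_0,x_1$ be real numbers such that $a,c<0$, $b,d>0$ and $x_0,x_1>0$. Then the piecewise system $$\begin{cases}\dot z=(a+ib)(z-i+x_1), & z\in\Sigma_+=\{\Im(z)>1\},\\ \dot z=iz, & z\in\Sigma_c=\{|\Im(z)|<1\},\\ \dot z=(c+id)(z+i-x_0), & z\in\Sigma_-=\{\Im(z)<-1\},\end{cases}$$ has a limit cycle.
   Context: Planar piecewise-smooth system ($z=x+iy\in\mathbb C\cong\mathbb R^2$) with discontinuity lines $\Im(z)=\pm1$, on which the dynamics follows Filippov's convention (where both adjacent vector fields cross the line in the same direction, trajectories are obtained by concatenation). A limit cycle is an isolated periodic orbit. *)

(* Defs.v *)
From HB Require Import structures.
From mathcomp Require Import all_boot all_order all_algebra.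
From mathcomp Require Import all_classical all_reals all_analysis.
From mathcomp Require Import complex.

Set Implicit Arguments.
Unset Strict Implicit.
Unset Printing Implicit Defensive.

Import Order.TTheory GRing.Theory Num.Theory.
Import numFieldNormedType.Exports.

Local Open Scope classical_set_scope.
Local Open Scope ring_scope.
Local Open Scope complex_scope.

(* The intervals [u i, v i] may share endpoints; only their interiors are
   disjoint. *)
Definition abs_continuous_on (R : realType) (f : R -> R) (a b : R) : Prop :=
  forall e : R, 0 < e -> exists2 d : R, 0 < d &
    forall (n : nat) (u v : 'I_n -> R),
      (forall i, a <= u i /\ u i <= v i /\ v i <= b) ->
      (forall i j, i != j -> v i <= u j \/ v j <= u i) ->
      \sum_(i < n) (v i - u i) < d ->
      \sum_(i < n) `|f (v i) - f (u i)| < e.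

Definition csegment (R : realType) (p q : R[i]) : set R[i] :=
  [set v | exists2 l : R, 0 <= l <= 1 & v = (1 - l)%:C * p + l%:C * q].

(* Filippov's set-valued extension of the field equal to Xp on Im z > 1, Xc on
   |Im z| < 1 and Xm on Im z < -1: on a discontinuity line it is the convex hull
   of the two adjacent fields. *)
Definition filippov_field (R : realType) (Xp Xc Xm : R[i] -> R[i]) (z : R[i]) :
    set R[i] :=
  if 1 < complex.Im z then [set Xp z]
  else if complex.Im z == 1 then csegment (Xc z) (Xp z)
  else if -1 < complex.Im z then [set Xc z]
  else if complex.Im z == -1 then csegment (Xm z) (Xc z)
  else [set Xm z].

Definition filippov_solution (R : realType) (F : R[i] -> set R[i])
    (g : R -> R[i]) : Prop :=
  (forall s t : R, abs_continuous_on (fun r => complex.Re (g r)) s t /\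
                   abs_continuous_on (fun r => complex.Im (g r)) s t) /\
  {ae @lebesgue_measure R, forall t : R, exists2 v : R[i], F (g t) v &
     is_derive t (1 : R) (fun r => complex.Re (g r) : R) (complex.Re v) /\
     is_derive t (1 : R) (fun r => complex.Im (g r) : R) (complex.Im v)}.

Definition periodic_orbit (R : realType) (F : R[i] -> set R[i])
    (G : set R[i]) : Prop :=
  exists g : R -> R[i],
    [/\ filippov_solution F g,
        exists2 T : R, 0 < T & forall t, g (t + T) = g t,
        exists s t : R, g s <> g t &
        G = range g].

(* Isolated: G has a neighbourhood which no other periodic orbit meets, not
   merely one which contains no other periodic orbit. *)
Definition limit_cycle (R : realType) (F : R[i] -> set R[i])
    (G : set R[i]) : Prop :=
  periodic_orbit F G /\
  exists2 e : R, 0 < e &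
    forall G' : set R[i], periodic_orbit F G' ->
      (exists z w : R[i], [/\ G z, G' w & `|w - z| < e%:C]) -> G' = G.

(* Main.v *)
(* In each open region a solution coincides with the explicit spiral or
   rotation, because undoing the linear flow turns it into an absolutely
   continuous function with zero derivative a.e.; at a point of a discontinuity
   line where both fields point to the same side, the convex hull has normal
   component bounded away from 0, so the solution crosses at once.  The return
   map on the half-line Im z = 1, Re z > 0 is therefore explicit and affine, with slope
   exp(c pi / d) exp(a pi / b) < 1; its fixed point p carries the cycle.

   For isolation, solutions are not unique forward in time on the unstable
   sliding segments, and the unit disc is filled with periodic orbits; but every
   solution through a point outside the closed disc and the closed segments
   reaches the section and its returns tend to p + i.  A periodic orbit is
   compact, so it contains p + i, and forward uniqueness from p + i makes it the
   cycle.  The cycle is compact and the excluded set closed, which gives the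
   neighbourhood.  The symmetry z -> -z, which exchanges (a, b, x1) with
   (c, d, x0), reduces everything to the upper half turn. *)
Require Import Defs.
From mathcomp Require Import all_boot all_order all_algebra.
From mathcomp Require Import all_classical all_reals all_analysis.
From mathcomp Require Import measurable_realfun complex ring lra.

Set Implicit Arguments.
Unset Strict Implicit.
Unset Printing Implicit Defensive.

Import Order.TTheory GRing.Theory Num.Theory.
Import numFieldNormedType.Exports.

Local Open Scope classical_set_scope.
Local Open Scope ring_scope.
Local Open Scope complex_scope.

(** * Absolute continuity and monotonicity *)

(** Stands in for the compactness of [[a, b]] in the arguments below. The supremum [s] of the [t]
    with [P a t] satisfies [P a s], and if [s < b] the local hypothesis at [s] would push past it.
    That hypothesis only concerns intervals containing [r]. *)
Lemma interval_induction (R : realType) (P : R -> R -> Prop) (a b : R) :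
  a <= b ->
  (forall u v w, u <= v -> v <= w -> P u v -> P v w -> P u w) ->
  (forall r, a <= r <= b -> exists2 e : R, 0 < e & forall u v,
     a <= u -> v <= b -> r - e < u -> u <= r -> r <= v -> v < r + e -> P u v) ->
  P a b.
Proof.
move=> ab Ptrans Ploc.
pose S := [set t | a <= t <= b /\ P a t].
have Sa : S a.
  split; first by rewrite lexx.
  have [|e e0 He] := Ploc a; first by rewrite lexx.
  by apply: He => //; lra.
have ubS : ubound S b by move=> t [/andP[]].
have supS : has_sup S by split; [exists a | exists b].
set s := sup S.
have as_ : a <= s by apply: ub_le_sup => //; exists b.
have sb : s <= b by apply: ge_sup => //; exists a.
have [|e e0 He] := Ploc s; first by rewrite as_ sb.
have [t [/andP[at_ tb] Pat] st] := sup_adherent e0 supS.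
have ts : t <= s by apply: ub_le_sup => //; [exists b|split => //; rewrite at_].
have Pas : P a s by apply: (Ptrans a t s) => //; apply: He => //; lra.
have [sltb|] := ltP s b; last by move=> bs; rewrite (_ : b = s) //; lra.
pose v := Num.min b (s + e / 2).
have vb : v <= b by rewrite ge_min lexx.
have vs : s < v by rewrite lt_min sltb /=; lra.
have ve : v < s + e by rewrite gt_min; apply/orP; right; lra.
have : v <= s; last by lra.
apply: ub_le_sup; first by exists b.
split; first by apply/andP; split => //; lra.
by apply: (Ptrans a s v) => //; [lra|apply: He => //; lra].
Qed.

Lemma is_derive_near (R : realType) (f : R -> R) (t l e : R) :
  is_derive t (1 : R) f l -> 0 < e ->
  exists2 d : R, 0 < d &
    forall u, `|u - t| < d -> `|f u - f t - l * (u - t)| <= e * `|u - t|.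
Proof.
move=> [df dl] e0.
have : (fun h : R => h^-1 *: (f (h *: (1 : R) + t) - f t)) @ 0^' --> l.
  by rewrite -dl; exact: df.
move=> /cvgrPdist_le/(_ e e0) /nbhs_ballP[d /= d0 Hd].
exists d => // u ut.
have [->|ut0] := eqVneq u t; first by rewrite !subrr mulr0 subrr normr0 mulr0.
have h0 : u - t != 0 by rewrite subr_eq0.
have := Hd (u - t); rewrite /ball /= sub0r normrN => /(_ ut h0).
rewrite -[X in f (X + t)]/((u - t) * 1) mulr1 subrK.
rewrite -[X in l - X]/((u - t)^-1 * (f u - f t)) => H.
have -> : f u - f t - l * (u - t) = - ((l - (u - t)^-1 * (f u - f t)) * (u - t)).
  by field.
by rewrite normrN normrM ler_wpM2r.
Qed.

(** The gaps between consecutive pieces are left free: there a derivative will control the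
    increment, while the pieces inside [U] will be charged to absolute continuity. *)
Fixpoint chain (R : realType) (U : set R) (u : R) (S : seq (R * R)) (v : R) :
    Prop :=
  if S is pq :: S' then
    [/\ u <= pq.1, pq.1 <= pq.2, `[pq.1, pq.2] `<=` U & chain U pq.2 S' v]
  else u <= v.

Section chain.
Variables (R : realType) (U : set R).

Lemma chain_le u S v : chain U u S v -> u <= v.
Proof.
elim: S u => [//|[p q] S IH] u /= [up pq _ /IH qv].
by rewrite (le_trans up) // (le_trans pq).
Qed.

Lemma chain_cat u S v S' w :
  chain U u S v -> chain U v S' w -> chain U u (S ++ S') w.
Proof.
elim: S u => [|[p q] S IH] u /=; last by move=> [? ? ? /IH H] /H.
by case: S' => [|[p q] S'] /= uv; [exact: le_trans | move=> [? ? ? ?]; split;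
  rewrite // (le_trans uv)].
Qed.

Lemma chain_bound u S v i : chain U u S v -> (i < size S)%N ->
  [/\ u <= (nth (0, 0) S i).1, (nth (0, 0) S i).1 <= (nth (0, 0) S i).2 &
      (nth (0, 0) S i).2 <= v].
Proof.
elim: S u i => [//|[p q] S IH] u [|i] /= [up pq _ qv].
  by split => //; exact: chain_le qv.
rewrite ltnS => /(IH _ _ qv)[? ? ?]; split => //.
by rewrite (le_trans up) // (le_trans pq).
Qed.

Lemma chain_disjoint u S v i j : chain U u S v ->
  (i < j)%N -> (j < size S)%N -> (nth (0, 0) S i).2 <= (nth (0, 0) S j).1.
Proof.
elim: S u i j => [//|[p q] S IH] u [|i] [|j] //= [up pq _ qv].
  by rewrite ltnS => _ /(chain_bound qv)[].
by rewrite !ltnS; exact: IH qv.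
Qed.

(** Pieces may share endpoints, so lengths are counted on half-open intervals, which are disjoint;
    additivity of the measure then applies. *)
Lemma chain_measure u S v : open U -> chain U u S v ->
  ((\sum_(pq <- S) (pq.2 - pq.1))%:E <= lebesgue_measure (U `&` `[u, v[))%E.
Proof.
move=> oU; elim: S u => [|[p q] S IH] u /=; first by rewrite big_nil measure_ge0.
move=> [up pq pqU qv]; rewrite big_cons /=.
have mU : measurable U by exact: open_measurable.
have qv' := chain_le qv.
have -> : ((q - p + \sum_(j <- S) (j.2 - j.1))%:E =
  lebesgue_measure (`[p, q[ : set R) + (\sum_(j <- S) (j.2 - j.1))%:E)%E.
  rewrite lebesgue_measure_itv /= lte_fin; case: ltP => // qp.
  by rewrite (_ : q = p) ?subrr ?add0e ?add0r //; apply/le_anti/andP.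
apply: le_trans (_ : lebesgue_measure (`[p, q[ : set R) +
   lebesgue_measure (U `&` `[q, v[) <= _)%E; first by rewrite leeD2l // IH.
rewrite -measureU //; last 2 first.
  by apply: measurableI => //; exact: measurable_itv.
  apply/seteqP; split => // x /=; rewrite !in_itv /=.
  move=> [/andP[_ xq] [_ /andP[qx _]]].
  by move: (lt_le_trans xq qx); rewrite ltxx.
apply: le_measure; rewrite ?inE; [|apply: measurableI => //|].
  by apply: measurableU; [|apply: measurableI].
move=> x /=; rewrite !in_itv /= => -[/andP[px xq]|[Ux /andP[qx xv]]].
  split; first by apply: pqU; rewrite /= in_itv /= px ltW.
  by rewrite (le_trans up) //= (lt_le_trans xq).
by split => //; rewrite xv andbT (le_trans up) // (le_trans pq).
Qed.

End chain.

(* Cousin-type argument: the exceptional null set is covered by an open set of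
   measure below the modulus of absolute continuity; the segment is cut into
   pieces on which either the derivative controls the increment or which lie in
   that open set. *)
Lemma ac_nondecreasing (R : realType) (f : R -> R) (s t : R) :
  s <= t -> abs_continuous_on f s t ->
  {ae @lebesgue_measure R, forall r : R, s < r < t ->
     exists2 l, 0 <= l & is_derive r (1 : R) f l} ->
  f s <= f t.
Proof.
move=> st acf [N [mN N0 NP]].
apply/ler_addgt0Pr => e' e'0.
(* The error is spent twice: [e * (t - s)] on the derivative and one more [e] on the variation over
   the exceptional set. *)
pose e := e' / (t - s + 1).
have e0 : 0 < e by rewrite divr_gt0 //; lra.
have ee : e * (t - s) + e = e' by rewrite /e; field; lra.
have [d d0 Hd] := acf e e0.
(* The endpoints join the null set because the derivative is only known strictly between them. *)
pose A := N `|` ([set s] `|` [set t]).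
have mA : measurable A by do 2 apply: measurableU => //.
have A0 : lebesgue_measure A = 0%E.
  apply/eqP; rewrite eq_le measure_ge0 andbT.
  apply: (le_trans (measureU2 _ _ _)) => //; first by apply: measurableU.
  rewrite [X in (X + _)%E]N0 add0e le_eqVlt; apply/orP; left; apply/eqP.
  by apply/countable_lebesgue_measure0/finite_set_countable; rewrite finite_setU.
have [|U [oU AU Ud]] := lebesgue_regularity_outer mA _ d0; first by rewrite [X in (X < _)%E]A0.
have mU : measurable U by exact: open_measurable.
have {}Ud : (lebesgue_measure U < d%:E)%E.
  apply: le_lt_trans Ud; rewrite -{1}(setDKU AU).
  apply: (le_trans (measureU2 _ _ _)) => //; first exact: measurableD.
  by rewrite [X in (_ + X)%E]A0 adde0.
(* Two losses are allowed in the lower bound, the derivative error over the length and the variation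
   along the chain; both add up under concatenation. Near a point of [A] the chain is the interval
   itself, elsewhere it is empty. *)
have [S [chS HS]] : exists S, chain U s S t /\
  - e * (t - s) - \sum_(pq <- S) `|f pq.2 - f pq.1| <= f t - f s.
  apply: (interval_induction (P := fun u v => exists S, chain U u S v /\
    - e * (v - u) - \sum_(pq <- S) `|f pq.2 - f pq.1| <= f v - f u)) => //.
    move=> u v w uv vw [S1 [c1 H1]] [S2 [c2 H2]].
    exists (S1 ++ S2); split; first exact: chain_cat c1 c2.
    by rewrite big_cat /=; lra.
  move=> r /andP[sr rt].
  have [rA|rA] := pselect (A r).
    have := oU; rewrite openE => /(_ r (AU _ rA)) /nbhs_ballP[k /= k0 kU].
    exists k => // u v _ _ ru ur rv vr; have uv := le_trans ur rv.
    exists [:: (u, v)]; split => /=.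
      split => // x /=; rewrite in_itv /= => /andP[ux xv].
      by apply: kU; rewrite /ball /= ltr_norml; lra.
    rewrite big_cons big_nil addr0 /=.
    have := mulr_ge0 (ltW e0) (_ : 0 <= v - u); rewrite subr_ge0 => /(_ uv).
    have := lerNnormlW (lexx `|f v - f u|).
    lra.
  have [l l0 fl] : exists2 l, 0 <= l & is_derive r (1 : R) f l.
    have [rN|rN] := pselect (N r); first by case: rA; left.
    apply: contrapT => H; apply: rN; apply: NP => /= H2; apply: H; apply: H2.
    rewrite !lt_neqAle sr rt !andbT; apply/andP; split; apply/eqP => E; apply: rA.
      by right; left.
    by right; right.
  have [k k0 Hk] := is_derive_near fl e0.
  exists k => // u v _ _ ru ur rv vr; exists [::]; split; first exact: le_trans rv.
  rewrite big_nil subr0.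
  have := Hk u; have := Hk v.
  rewrite (ger0_norm (_ : 0 <= v - r)) ?subr_ge0 //.
  rewrite (ler0_norm (_ : u - r <= 0)) ?subr_le0 //.
  move=> /(_ ltac:(lra)); rewrite ler_norml => /andP[H1 _].
  move=> /(_ ltac:(lra)); rewrite ler_norml => /andP[_ H2].
  have := mulr_ge0 l0 (_ : 0 <= v - u); rewrite subr_ge0 => /(_ (le_trans ur rv)).
  lra.
have := Hd (size S) (fun i => (nth (0, 0) S i).1) (fun i => (nth (0, 0) S i).2)
  (fun i => let: And3 x y z := chain_bound chS (ltn_ord i) in conj x (conj y z)).
have sumE (F : R * R -> R) :
    \sum_(i < size S) F (nth (0, 0) S i) = \sum_(pq <- S) F pq.
  by rewrite (big_nth (0, 0)) big_mkord.
rewrite (sumE (fun pq => `|f pq.2 - f pq.1|)) (sumE (fun pq => pq.2 - pq.1)).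
move=> H; suff : \sum_(pq <- S) `|f pq.2 - f pq.1| < e by lra.
apply: H.
  move=> i j; rewrite neq_ltn => /orP[ij|ji].
    left; exact: chain_disjoint chS ij (ltn_ord j).
  right; exact: chain_disjoint chS ji (ltn_ord i).
rewrite -lte_fin; apply: le_lt_trans Ud.
apply: le_trans (chain_measure oU chS) _.
by apply: le_measure; rewrite ?inE //; exact: measurableI.
Qed.

(** * Calculus of absolutely continuous functions *)

Lemma ae_imply (R : realType) (P Q : R -> Prop) :
  (forall r, P r -> Q r) -> {ae @lebesgue_measure R, forall r, P r} ->
  {ae @lebesgue_measure R, forall r, Q r}.
Proof.
move=> PQ [A [mA A0 PA]]; exists A; split => // x nQ.
by apply: PA => /= /PQ.
Qed.

Lemma ac_modulus (R : realType) (f : R -> R) (s t e : R) :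
  abs_continuous_on f s t -> 0 < e -> exists2 d : R, 0 < d &
    forall u v, s <= u -> u <= v -> v <= t -> v - u < d -> `|f v - f u| < e.
Proof.
move=> acf e0; have [d d0 Hd] := acf e e0; exists d => // u v su uv vt uvd.
have := Hd 1%N (fun=> u) (fun=> v); rewrite !big_ord1; apply => //.
by move=> i j; rewrite !ord1 eqxx.
Qed.

Lemma ac_bounded (R : realType) (f : R -> R) (s t : R) : s <= t ->
  abs_continuous_on f s t ->
  exists2 M : R, 0 < M & forall r, s <= r <= t -> `|f r| <= M.
Proof.
move=> st acf; have [d d0 Hd] := ac_modulus acf ltr01.
apply: (interval_induction (P := fun u v =>
  exists2 M : R, 0 < M & forall r, u <= r <= v -> `|f r| <= M)) => //.
  move=> u v w uv vw [M1 M10 H1] [M2 M20 H2]; exists (M1 + M2); first by lra.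
  move=> r /andP[ur rw]; have [rv|vr] := leP r v.
    by have := H1 r; rewrite ur rv => /(_ isT); lra.
  by have := H2 r; rewrite (ltW vr) rw => /(_ isT); lra.
move=> r /andP[sr rt]; exists d => // u v su vt ru ur rv vr.
exists (`|f r| + 1); first by have := normr_ge0 (f r); lra.
move=> x /andP[ux xv]; rewrite -lerBlDl.
apply: le_trans (lerB_dist _ _) _; apply: ltW.
have [xr|rx] := leP x r; last by apply: Hd; lra.
by rewrite distrC; apply: Hd; lra.
Qed.

Lemma ac_lipschitz (R : realType) (f : R -> R) (s t K : R) :
  (forall u v, s <= u -> u <= v -> v <= t -> `|f v - f u| <= K * (v - u)) ->
  abs_continuous_on f s t.
Proof.
(* [K] carries no sign, hence its absolute value, plus one to divide by a positive number. *)
move=> fK e e0; exists (e / (`|K| + 1)).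
  by rewrite divr_gt0 // ltr_wpDl.
move=> n u v uv _; rewrite ltr_pdivlMr ?ltr_wpDl // => H.
apply: le_lt_trans H; rewrite mulr_suml; apply: ler_sum => i _.
have [su [uvi vt]] := uv i.
apply: le_trans (fK _ _ su uvi vt) _; rewrite mulrC ler_wpM2l ?subr_ge0 //.
by apply: le_trans (ler_norm _) _; rewrite lerDl.
Qed.

Lemma ac_add (R : realType) (f g : R -> R) (s t : R) :
  abs_continuous_on f s t -> abs_continuous_on g s t ->
  abs_continuous_on (fun r => f r + g r) s t.
Proof.
move=> acf acg e e0; have e20 : 0 < e / 2 by lra.
have [d1 d10 H1] := acf _ e20; have [d2 d20 H2] := acg _ e20.
exists (Num.min d1 d2); first by rewrite lt_min d10.
move=> n u v uv dis; rewrite lt_min => /andP[ud1 ud2].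
have := H1 n u v uv dis ud1; have := H2 n u v uv dis ud2.
suff : \sum_(i < n) `|f (v i) + g (v i) - (f (u i) + g (u i))| <=
  \sum_(i < n) `|f (v i) - f (u i)| + \sum_(i < n) `|g (v i) - g (u i)| by lra.
rewrite -big_split; apply: ler_sum => i _ /=.
by rewrite opprD addrACA ler_normD.
Qed.

Lemma ac_mul (R : realType) (f g : R -> R) (s t : R) : s <= t ->
  abs_continuous_on f s t -> abs_continuous_on g s t ->
  abs_continuous_on (fun r => f r * g r) s t.
Proof.
move=> st acf acg e e0.
have [M M0 fM] := ac_bounded st acf; have [M' M'0 gM] := ac_bounded st acg.
have [d1 d10 H1] := acf (e / 2 / M') ltac:(by rewrite !divr_gt0).
have [d2 d20 H2] := acg (e / 2 / M) ltac:(by rewrite !divr_gt0).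
exists (Num.min d1 d2); first by rewrite lt_min d10.
move=> n u v uv dis; rewrite lt_min => /andP[ud1 ud2].
have := H1 n u v uv dis ud1; have := H2 n u v uv dis ud2.
rewrite !ltr_pdivlMr //.
suff : \sum_(i < n) `|f (v i) * g (v i) - f (u i) * g (u i)| <=
  (\sum_(i < n) `|f (v i) - f (u i)|) * M' +
  (\sum_(i < n) `|g (v i) - g (u i)|) * M by lra.
rewrite !mulr_suml -big_split; apply: ler_sum => i _ /=.
have [su [uvi vt]] := uv i.
have -> : f (v i) * g (v i) - f (u i) * g (u i) =
  (f (v i) - f (u i)) * g (v i) + (g (v i) - g (u i)) * f (u i) by ring.
apply: le_trans (ler_normD _ _) _; rewrite !normrM.
by rewrite lerD // ler_wpM2l // ?gM ?fM // ?su ?vt ?andbT //=; lra.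
Qed.

Lemma ac_cst (R : realType) (k s t : R) : abs_continuous_on (fun=> k) s t.
Proof. by apply: (@ac_lipschitz _ _ _ _ 0) => *; rewrite subrr normr0 mul0r. Qed.

Lemma ac_opp (R : realType) (f : R -> R) (s t : R) :
  abs_continuous_on f s t -> abs_continuous_on (fun r => - f r) s t.
Proof.
move=> acf e e0; have [d d0 Hd] := acf e e0; exists d => // n u v uv dis ud.
apply: le_lt_trans (Hd n u v uv dis ud); apply: ler_sum => i _.
by rewrite -opprD normrN.
Qed.

(** Subtracting the linear function of slope [m] reduces this to [ac_nondecreasing]. *)
Lemma ac_slope_ge (R : realType) (f : R -> R) (s t m : R) :
  s <= t -> abs_continuous_on f s t ->
  {ae @lebesgue_measure R, forall r : R, s < r < t ->
     exists2 l, m <= l & is_derive r (1 : R) f l} ->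
  m * (t - s) <= f t - f s.
Proof.
move=> st acf df.
suff : f s + - m * s <= f t + - m * t by lra.
apply: (ac_nondecreasing (f := fun r => f r + - m * r)) => //.
  apply: ac_add => //; apply: ac_mul => //; first exact: ac_cst.
  apply: (@ac_lipschitz _ _ _ _ 1) => u v _ uv _.
  by rewrite ger0_norm ?subr_ge0 // mul1r.
apply: ae_imply df => r H /H[l ml fl]; exists (l - m); first by lra.
have dm : is_derive r (1 : R) (fun x : R => - m * x) (- m * 1).
  exact: is_deriveZ.
by have := is_deriveD fl dm; rewrite mulr1.
Qed.

Lemma ac_constant (R : realType) (f : R -> R) (s t : R) :
  s <= t -> abs_continuous_on f s t ->
  {ae @lebesgue_measure R, forall r : R, s < r < t -> is_derive r (1 : R) f 0} ->
  f t = f s.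
Proof.
move=> st acf df.
have /(_ 0) := ac_slope_ge st acf.
have /(_ 0) := ac_slope_ge st (ac_opp acf).
rewrite !mul0r => H1 H2; apply/eqP; rewrite eq_le; apply/andP; split.
  suff : 0 <= - f t - - f s by lra.
  apply: H1; apply: ae_imply df => r H /H fl; exists 0 => //.
  by have := is_deriveN fl; rewrite oppr0.
rewrite -subr_ge0; apply: H2; apply: ae_imply df => r H /H fl; by exists 0.
Qed.

Lemma derive_bounded_lipschitz (R : realType) (f df : R -> R) (s t K : R) :
  (forall r, is_derive r (1 : R) f (df r)) ->
  (forall r, s <= r <= t -> `|df r| <= K) ->
  forall u v, s <= u -> u <= v -> v <= t -> `|f v - f u| <= K * (v - u).
Proof.
move=> fd dfK u v su uv vt.
have cf : {within `[u, v], continuous f}.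
  by apply: derivable_within_continuous => x _; exact: ex_derive.
have [c + ->] := MVT_segment uv (fun x _ => fd x) cf.
rewrite in_itv /= => /andP[uc cv].
rewrite normrM (ger0_norm (_ : 0 <= v - u)) ?subr_ge0 //.
by rewrite ler_wpM2r ?subr_ge0 // dfK //; lra.
Qed.

Lemma ac_derive_bounded (R : realType) (f df : R -> R) (s t K : R) :
  (forall r, is_derive r (1 : R) f (df r)) ->
  (forall r, s <= r <= t -> `|df r| <= K) -> abs_continuous_on f s t.
Proof. by move=> fd dfK; exact: ac_lipschitz (derive_bounded_lipschitz fd dfK). Qed.

(** * Exponentials, rotations and uniqueness for linear planar systems *)

Section exp_trig.
Variables (R : realType) (k s : R).

Lemma is_derive_comp_affine (f : R -> R) (r l : R) :
  is_derive (k * (r - s)) (1 : R) f l ->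
  is_derive r (1 : R) (fun x => f (k * (x - s))) (k * l).
Proof.
move=> fl; rewrite mulrC.
apply: (@is_derive1_comp _ f (fun x => k * (x - s))) => //.
have H : is_derive r (1 : R) (fun x : R => x - s) (1 - 0) by apply: is_deriveB.
have := is_deriveZ k H.
by rewrite (_ : k *: (1 - 0) = k :> R) // subr0 /GRing.scale /= mulr1.
Qed.

Lemma is_derive_expR_affine (r : R) :
  is_derive r (1 : R) (fun x => expR (k * (x - s))) (k * expR (k * (r - s))).
Proof. exact: is_derive_comp_affine. Qed.

Lemma is_derive_cos_affine (r : R) :
  is_derive r (1 : R) (fun x => cos (k * (x - s))) (k * - sin (k * (r - s))).
Proof. exact: is_derive_comp_affine. Qed.

Lemma is_derive_sin_affine (r : R) :
  is_derive r (1 : R) (fun x => sin (k * (x - s))) (k * cos (k * (r - s))).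
Proof. exact: is_derive_comp_affine. Qed.

Lemma ac_expR_affine (u v : R) :
  abs_continuous_on (fun x => expR (k * (x - s))) u v.
Proof.
apply: (@ac_derive_bounded _ _ _ _ _
  (`|k| * (expR (k * (u - s)) + expR (k * (v - s)))) is_derive_expR_affine).
move=> r /andP[ur rv]; rewrite normrM ler_wpM2l // ger0_norm ?expR_ge0 //.
have [k0|k0] := leP 0 k.
  have := expR_ge0 (k * (u - s)); suff : expR (k * (r - s)) <= expR (k * (v - s)).
    by lra.
  by rewrite ler_expR ler_wpM2l //; lra.
have := expR_ge0 (k * (v - s)); suff : expR (k * (r - s)) <= expR (k * (u - s)).
  by lra.
by rewrite ler_expR ler_wnM2l //; lra.
Qed.

Lemma ac_cos_affine (u v : R) : abs_continuous_on (fun x => cos (k * (x - s))) u v.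
Proof.
apply: (@ac_derive_bounded _ _ _ _ _ `|k| is_derive_cos_affine) => r _.
by rewrite normrM normrN ler_piMr // sin_max.
Qed.

Lemma ac_sin_affine (u v : R) : abs_continuous_on (fun x => sin (k * (x - s))) u v.
Proof.
apply: (@ac_derive_bounded _ _ _ _ _ `|k| is_derive_sin_affine) => r _.
by rewrite normrM ler_piMr // cos_max.
Qed.

End exp_trig.

(** [C] and [S] enter only through their differential equations, so one computation serves both
    coordinates: the pair [(S, -C)] may replace [(C, S)]. It is used to undo a flow, with moving [p]
    and [q], and to differentiate a spiral, with constant ones. *)
Lemma is_derive_rotation (R : realType) (p q C S : R -> R) (E : R -> R)
  (r al be p' q' : R) :
  is_derive r (1 : R) p p' -> is_derive r (1 : R) q q' ->
  is_derive r (1 : R) E (al * E r) ->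
  is_derive r (1 : R) C (be * - S r) -> is_derive r (1 : R) S (be * C r) ->
  is_derive r (1 : R) (fun x => E x * (C x * p x + S x * q x))
   (E r * (C r * (al * p r + be * q r + p') + S r * (al * q r - be * p r + q'))).
Proof.
move=> dp dq dE dC dS.
have H := is_deriveM dE (is_deriveD (is_deriveM dC dp) (is_deriveM dS dq)).
by apply: is_derive_eq H _; rewrite /GRing.scale /= !fctE; ring.
Qed.

(* Undoing the rotation and the dilation turns the solution into a constant. *)
Lemma linear_flow_unique (R : realType) (p q : R -> R) (al be s t : R) :
  s <= t -> abs_continuous_on p s t -> abs_continuous_on q s t ->
  {ae @lebesgue_measure R, forall r : R, s < r < t ->
     is_derive r (1 : R) p (al * p r - be * q r) /\
     is_derive r (1 : R) q (be * p r + al * q r)} ->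
  p t = expR (al * (t - s)) *
          (cos (be * (t - s)) * p s - sin (be * (t - s)) * q s) /\
  q t = expR (al * (t - s)) *
          (sin (be * (t - s)) * p s + cos (be * (t - s)) * q s).
Proof.
move=> st acp acq dpq.
pose E r := expR (- al * (r - s)).
pose C r := cos (be * (r - s)); pose S r := sin (be * (r - s)).
have dE r : is_derive r (1 : R) E (- al * E r) by exact: is_derive_expR_affine.
have dC r : is_derive r (1 : R) C (be * - S r) by exact: is_derive_cos_affine.
have dS r : is_derive r (1 : R) S (be * C r) by exact: is_derive_sin_affine.
have acE : abs_continuous_on E s t by exact: ac_expR_affine.
have acC : abs_continuous_on C s t by exact: ac_cos_affine.
have acS : abs_continuous_on S s t by exact: ac_sin_affine.
have H1 : E t * (C t * p t + S t * q t) = E s * (C s * p s + S s * q s).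
  apply: (@ac_constant _ (fun r => E r * (C r * p r + S r * q r))) => //.
    by apply: ac_mul => //; apply: ac_add => //; apply: ac_mul.
  apply: ae_imply dpq => r H /H[dp dq].
  by apply: is_derive_eq (is_derive_rotation dp dq (dE r) (dC r) (dS r)) _; ring.
have dC' r : is_derive r (1 : R) (fun r => - C r) (be * S r).
  by apply: is_derive_eq (is_deriveN (dC r)) _; ring.
(* Taking [(S, -C)] for [(C, S)] yields the opposite of the second coordinate rotated back. *)
have H2 : E t * (S t * p t + - C t * q t) = E s * (S s * p s + - C s * q s).
  apply: (@ac_constant _ (fun r => E r * (S r * p r + - C r * q r))) => //.
    apply: ac_mul => //; apply: ac_add => //; apply: ac_mul => //.
    exact: ac_opp.
  apply: ae_imply dpq => r H /H[dp dq].
  apply: is_derive_eq (is_derive_rotation (S := fun r => - C r) (be := be) dp dq (dE r) _ (dC' r)) _.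
    by apply: is_derive_eq (dS r) _; ring.
  by ring.
have Es : E s = 1 by rewrite /E subrr mulr0 expR0.
have Cs : C s = 1 by rewrite /C subrr mulr0 cos0.
have Ss : S s = 0 by rewrite /S subrr mulr0 sin0.
rewrite Es Cs Ss !mul1r !mul0r addr0 add0r in H1 H2.
have EE : expR (al * (t - s)) * E t = 1.
  by rewrite /E mulNr expRN divff // gt_eqF // expR_gt0.
have CS : C t ^+ 2 + S t ^+ 2 = 1 by exact: cos2Dsin2.
have qs : q s = - (E t * (S t * p t + - C t * q t)) by rewrite H2; ring.
rewrite -/(C t) -/(S t); split.
  (* The inserted factors equal 1; expanding them inverts the rotation and the dilation. *)
  transitivity (expR (al * (t - s)) * E t * (C t ^+ 2 + S t ^+ 2) * p t).
    by rewrite EE CS !mul1r.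
  by rewrite qs -H1; ring.
transitivity (expR (al * (t - s)) * E t * (C t ^+ 2 + S t ^+ 2) * q t).
  by rewrite EE CS !mul1r.
by rewrite qs -H1; ring.
Qed.

(** * The piecewise field and its central symmetry *)

Definition pws_field (R : realType) (a b c d x0 x1 : R) : R[i] -> set R[i] :=
  filippov_field
    (fun z : R[i] => (a +i* b) * (z - 'i%C + x1%:C))
    (fun z : R[i] => 'i%C * z)
    (fun z : R[i] => (c +i* d) * (z + 'i%C - x0%:C)).

Lemma complex_eqP (R : realType) (z w : R[i]) :
  complex.Re z = complex.Re w -> complex.Im z = complex.Im w -> z = w.
Proof. by case: z w => [? ?] [? ?] /= -> ->. Qed.

Section field.
Variables (R : realType) (a b c d x0 x1 : R).
Local Notation F := (pws_field a b c d x0 x1).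

Lemma pws_field_up (z v : R[i]) : 1 < complex.Im z ->
  F z v <-> complex.Re v = a * (complex.Re z + x1) - b * (complex.Im z - 1) /\
            complex.Im v = b * (complex.Re z + x1) + a * (complex.Im z - 1).
Proof.
rewrite /pws_field /filippov_field => ->; case: z v => [x y] [u w] /=; split.
  by move=> -[-> ->]; split; ring.
by move=> [-> ->]; apply: complex_eqP => /=; ring.
Qed.

Lemma pws_field_mid (z v : R[i]) : -1 < complex.Im z < 1 ->
  F z v <-> complex.Re v = - complex.Im z /\ complex.Im v = complex.Re z.
Proof.
rewrite /pws_field /filippov_field => /andP[y1 y2].
rewrite ltNge (ltW y2) /= lt_eqF // y1; case: z v y1 y2 => [x y] [u w] /= _ _.
split; first by move=> -[-> ->]; split; ring.
by move=> [-> ->]; apply: complex_eqP => /=; ring.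
Qed.

(** One formula covers three zones: [l = 0] in the strip, [l = 1] above the line, and on the line
    [l] is the weight of the convex combination, the term in [a] being zero there. A vertical speed
    can thus be bounded across the line without splitting cases. *)
Lemma pws_field_Im (z v : R[i]) : -1 < complex.Im z -> F z v ->
  exists2 l : R, 0 <= l <= 1 &
    complex.Im v = (1 - l) * complex.Re z +
                   l * (b * (complex.Re z + x1) + a * (complex.Im z - 1)).
Proof.
move=> y1; have [y2|y2|y2] := ltgtP (complex.Im z) 1.
- move/pws_field_mid => [|_ ->]; first by rewrite y1.
  by exists 0; rewrite ?lexx ?ler01 //; ring.
- move/pws_field_up => [//|_ ->].
  by exists 1; rewrite ?lexx ?ler01 //; ring.
- rewrite /pws_field /filippov_field y2 ltxx eqxx => -[l l01 ->].
  exists l => //; case: z y1 y2 => [x y] /= _ ->; ring.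
Qed.

Lemma pws_fieldN (z v : R[i]) :
  F z v -> pws_field c d a b x1 x0 (- z) (- v).
Proof.
case: z => x y; rewrite /pws_field /filippov_field /=.
have E1 : (1 < - y) = (y < -1) by rewrite ltrNr.
have E2 : (-1 < - y) = (y < 1) by rewrite ltrN2.
have E3 : (- y == 1) = (y == -1) by rewrite eqr_oppLR.
have E4 : (- y == -1) = (y == 1) by rewrite eqr_opp.
rewrite E1 E2 E3 E4.
have n11 : (-1 : R) < 1 by lra.
have [y1|y1|<-] := ltgtP 1 y.
- rewrite (lt_gtF (lt_trans n11 y1)) (gt_eqF (lt_trans n11 y1)).
  by move=> ->; apply: complex_eqP => /=; ring.
- have [y2|y2|<-] := ltgtP (-1) y.
  + by move=> ->; apply: complex_eqP => /=; ring.
  + by move=> ->; apply: complex_eqP => /=; ring.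
  (* The symmetry exchanges the ends of the segment, so the weight [l] becomes [1 - l]. *)
  + move=> [l /andP[l0 l1] ->]; exists (1 - l); first by apply/andP; split; lra.
    by apply: complex_eqP => /=; ring.
- rewrite (lt_gtF n11) (gt_eqF n11).
  move=> [l /andP[l0 l1] ->]; exists (1 - l); first by apply/andP; split; lra.
  by apply: complex_eqP => /=; ring.
Qed.

Lemma pws_solutionN (g : R -> R[i]) : filippov_solution F g ->
  filippov_solution (pws_field c d a b x1 x0) (fun t => - g t).
Proof.
move=> [acg dg].
have ReN : (fun r => complex.Re (- g r)) = - (fun r => complex.Re (g r)).
  by apply/funext => r; rewrite fctE; case: (g r).
have ImN : (fun r => complex.Im (- g r)) = - (fun r => complex.Im (g r)).
  by apply/funext => r; rewrite fctE; case: (g r).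
split.
  move=> s t; have [acr aci] := acg s t.
  by rewrite /= ReN ImN; split; exact: ac_opp.
apply: ae_imply dg => r [v Fv [dr di]]; exists (- v); first exact: pws_fieldN.
rewrite /= ReN ImN; case: v {Fv} dr di => p q /= dr di.
by split; exact: is_deriveN.
Qed.

End field.

(** * Spirals and the solutions that follow them *)

(** This is [p + exp((al + i be) r) (z - p)] in real coordinates; [al = 0], [be = 1], [p = 0] give
    the rotation of the strip. *)
Definition spiral (R : realType) (al be : R) (p z : R[i]) (r : R) : R[i] :=
  (complex.Re p + expR (al * r) * (cos (be * r) * (complex.Re z - complex.Re p) -
                                   sin (be * r) * (complex.Im z - complex.Im p)))
  +i*
  (complex.Im p + expR (al * r) * (sin (be * r) * (complex.Re z - complex.Re p) +
                                   cos (be * r) * (complex.Im z - complex.Im p))).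

Lemma solution_near (R : realType) (F : R[i] -> set R[i]) (g : R -> R[i])
  (s e : R) : filippov_solution F g -> 0 < e ->
  exists2 k : R, 0 < k & forall r, `|r - s| < k ->
    `|complex.Re (g r) - complex.Re (g s)| < e /\
    `|complex.Im (g r) - complex.Im (g s)| < e.
Proof.
move=> [acg _] e0; have [acr aci] := acg (s - 1) (s + 1).
have [k1 k10 H1] := ac_modulus acr e0; have [k2 k20 H2] := ac_modulus aci e0.
exists (Num.min 1 (Num.min k1 k2)); first by rewrite !lt_min ltr01 k10.
move=> r; rewrite !lt_min => /and3P[r1 rk1 rk2].
have [sr|rs] := leP s r.
  rewrite ger0_norm ?subr_ge0 // in r1 rk1 rk2.
  by split; [apply: H1|apply: H2] => //; lra.
rewrite ltr0_norm ?subr_lt0 // in r1 rk1 rk2.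
by split; rewrite distrC; [apply: H1|apply: H2] => //; lra.
Qed.

Section track.
Variables (R : realType) (F : R[i] -> set R[i]) (g : R -> R[i]).
Variables (al be : R) (p : R[i]) (I : R -> Prop) (s : R).
Hypothesis solg : filippov_solution F g.
Hypothesis FI : forall z v, I (complex.Im z) -> F z v ->
  complex.Re v = al * (complex.Re z - complex.Re p) -
                 be * (complex.Im z - complex.Im p) /\
  complex.Im v = be * (complex.Re z - complex.Re p) +
                 al * (complex.Im z - complex.Im p).

Lemma solution_spiral (r : R) : 0 <= r ->
  (forall r', 0 < r' < r -> I (complex.Im (g (s + r')))) ->
  g (s + r) = spiral al be p (g s) r.
Proof.
move=> r0 Ir; have [acg dg] := solg.
have [acr aci] := acg s (s + r).
have ssr : s <= s + r by rewrite lerDl.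
have [] := @linear_flow_unique R (fun t => complex.Re (g t) - complex.Re p)
  (fun t => complex.Im (g t) - complex.Im p) al be s (s + r) ssr.
- by apply: ac_add acr _; exact: ac_cst.
- by apply: ac_add aci _; exact: ac_cst.
- apply: ae_imply dg => t [v Fv [dr di]] /andP[st tr].
  have [|<- <-] := FI _ Fv.
    by rewrite (_ : t = s + (t - s)); [apply: Ir; lra | ring].
  split.
    have := is_deriveB dr (is_derive_cst (complex.Re p) t (1 : R)).
    by rewrite subr0.
  have := is_deriveB di (is_derive_cst (complex.Im p) t (1 : R)).
  by rewrite subr0.
rewrite (_ : s + r - s = r) => [H1 H2|]; last by ring.
by apply: complex_eqP => /=; [rewrite -H1 | rewrite -H2]; ring.
Qed.

Hypothesis openI : forall y, I y ->
  exists2 e : R, 0 < e & forall y', `|y' - y| < e -> I y'.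

(** First exit argument. Let [q] be the infimum of the times at which the solution is out of [I]. Up
    to and including [q] it is the spiral, which is still in [I] at [q]; openness of [I] and
    continuity then forbid exits just after [q]. The entrance hypothesis allows [g s] to lie on the
    border of the zone. *)
Lemma solution_track (tau : R) :
  (forall r, 0 < r < tau -> I (complex.Im (spiral al be p (g s) r))) ->
  (exists2 e : R, 0 < e & forall r, 0 < r < e -> I (complex.Im (g (s + r)))) ->
  forall r, 0 <= r <= tau -> g (s + r) = spiral al be p (g s) r.
Proof.
move=> Isp [e e0 He] r /andP[r0 rtau].
apply: solution_spiral => // r1 /andP[r10 r1r]; apply: contrapT => nI.
pose S := [set q | 0 < q <= r1 /\ ~ I (complex.Im (g (s + q)))].
have Sr1 : S r1 by split; rewrite ?r10 ?lexx.
have lbS : lbound S e.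
  move=> q [/andP[q0 _] nq]; rewrite leNgt; apply/negP => qe; apply: nq.
  by apply: He; rewrite q0.
have infS : has_inf S by split; [exists r1 | exists e].
set q := inf S.
have eq : e <= q by apply: lb_le_inf => //; exists r1.
have qr1 : q <= r1 by apply: ge_inf => //; exists e.
have Ilt q' : 0 < q' < q -> I (complex.Im (g (s + q'))).
  move=> /andP[q'0 q'q]; apply: contrapT => nq'.
  suff : q <= q' by lra.
  by apply: ge_inf; [exists e | split => //; rewrite q'0 /=; lra].
have Iq : I (complex.Im (g (s + q))).
  rewrite solution_spiral //; last by lra.
  by apply: Isp; apply/andP; split; lra.
have [k k0 Hk] := openI Iq.
have [h h0 Hh] := solution_near (s + q) solg k0.
have [q' [/andP[q'0 q'r1] nq'] q'q] := inf_adherent h0 infS.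
apply: (nq'); apply: Hk; apply: (proj2 (Hh _ _)).
have qq' : q <= q' by apply: ge_inf; [exists e | split; rewrite ?q'0].
rewrite (_ : _ - _ = q' - q); last by ring.
by rewrite ger0_norm; [|lra]; rewrite -/q in q'q; lra.
Qed.

End track.

(** [sg = 1] is the upward crossing and [sg = -1] the downward one. Near [g s] both adjacent fields
    have vertical component at least [m] in the direction [sg], hence so does every convex
    combination, and [ac_slope_ge] integrates this bound. *)
Lemma solution_cross (R : realType) (a b c d x0 x1 sg : R) (g : R -> R[i])
  (s : R) : 0 < b -> sg ^+ 2 = 1 ->
  filippov_solution (pws_field a b c d x0 x1) g ->
  complex.Im (g s) = 1 -> 0 < sg * complex.Re (g s) ->
  0 < sg * (complex.Re (g s) + x1) ->
  exists2 e : R, 0 < e & forall r, 0 < r < e ->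
    -1 < complex.Im (g (s + r)) /\ 0 < sg * (complex.Im (g (s + r)) - 1).
Proof.
move=> b0 sg2 solg gs1 h1 h2.
have nsg : `|sg| = 1.
  by apply/eqP; rewrite -(@eqrXn2 _ 2) // real_normK ?num_real // sg2 expr1n.
(* Half of the smaller speed at [g s]; the other half absorbs the variation nearby. *)
pose m := Num.min (sg * complex.Re (g s)) (b * (sg * (complex.Re (g s) + x1))) / 2.
have m0 : 0 < m by rewrite divr_gt0 // lt_min h1 mulr_gt0.
have m1 : 2 * m <= sg * complex.Re (g s).
  by rewrite mulrC /m divfK // ge_min lexx.
have m2 : 2 * m <= b * (sg * (complex.Re (g s) + x1)).
  by rewrite mulrC /m divfK // ge_min lexx orbT.
(* In this radius the changes of the real part and the term in [a] cost at most [m]; the bound 1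
   keeps the solution above the lower line. *)
pose h := Num.min 1 (m / (1 + b + `|a|)).
have D0 : 0 < 1 + b + `|a| by rewrite ltr_wpDr // addr_gt0.
have h0 : 0 < h by rewrite lt_min ltr01 divr_gt0.
have hm : h * (1 + b + `|a|) <= m by rewrite -ler_pdivlMr // ge_min lexx orbT.
have hle1 : h <= 1 by rewrite ge_min lexx.
have [k k0 Hk] := solution_near s solg h0.
have near r : s <= r < s + k -> `|sg * (complex.Re (g r) - complex.Re (g s))| < h /\
    `|sg * (complex.Im (g r) - 1)| < h /\ `|complex.Im (g r) - 1| < h.
  move=> /andP[sr rk]; rewrite -gs1 !normrM nsg !mul1r.
  have [|Hr Hi] := Hk r; first by rewrite ger0_norm; lra.
  by split.
exists k => // r /andP[r0 rk]; split.
  have [|_ [_]] := near (s + r); first by apply/andP; split; lra.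
  by rewrite ltr_norml => /andP[]; lra.
have [acg dg] := solg; have [_ aci] := acg s (s + r).
suff : m * (s + r - s) <= sg * complex.Im (g (s + r)) - sg * complex.Im (g s).
  rewrite gs1 mulr1 (_ : s + r - s = r) //; last by ring.
  have := mulr_gt0 m0 r0; lra.
apply: (ac_slope_ge (f := fun t => sg * complex.Im (g t))); first by lra.
  by apply: ac_mul => //; [lra | exact: ac_cst].
apply: ae_imply dg => t [v Fv [_ di]] /andP[st tr].
exists (sg * complex.Im v); last exact: is_deriveZ.
have [n1 [n2 n3]] : _ /\ _ /\ _ := near t ltac:(by apply/andP; split; lra).
have [|l /andP[l0 l1] ->] := pws_field_Im _ Fv.
  by move: n3; rewrite ltr_norml => /andP[]; lra.
have y1 : m <= sg * complex.Re (g t).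
  move: n1; rewrite ltr_norml => /andP[n1 _].
  have : h * 1 <= h * (1 + b + `|a|).
    by rewrite ler_pM2l //; have := normr_ge0 a; lra.
  by move: n1 m1 m2; lra.
have y2 : m <= b * (sg * (complex.Re (g t) + x1)) + sg * (a * (complex.Im (g t) - 1)).
  have E1 : b * (sg * (complex.Re (g t) - complex.Re (g s))) >= - (b * h).
    by rewrite -mulrN ler_pM2l //; move: n1; rewrite ltr_norml => /andP[]; lra.
  have E2 : - (`|a| * h) <= sg * (a * (complex.Im (g t) - 1)).
    rewrite mulrCA; apply: le_trans (lerNnormlW (lexx _)).
    by rewrite lerN2 normrM ler_wpM2l // ltW.
  have := E1; rewrite mulrBr mulrBr; move: E2 m2 hm; rewrite !mulrDr; lra.
have : 0 <= (1 - l) * (sg * complex.Re (g t) - m) by rewrite mulr_ge0 //; lra.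
have : 0 <= l * (b * (sg * (complex.Re (g t) + x1)) +
  sg * (a * (complex.Im (g t) - 1)) - m) by rewrite mulr_ge0 //; lra.
lra.
Qed.

(** * Arcs of the flow *)

Definition velocity_in (R : realType) (F : R[i] -> set R[i]) (g : R -> R[i])
    (t : R) : Prop :=
  exists2 v : R[i], F (g t) v &
    is_derive t (1 : R) (fun r => complex.Re (g r) : R) (complex.Re v) /\
    is_derive t (1 : R) (fun r => complex.Im (g r) : R) (complex.Im v).

Definition lipschitz_path (R : realType) (K : R) (g : R -> R[i]) (s t : R) :=
  forall u v : R, s <= u -> u <= v -> v <= t ->
    `|complex.Re (g v) - complex.Re (g u)| <= K * (v - u) /\
    `|complex.Im (g v) - complex.Im (g u)| <= K * (v - u).

(** The Lipschitz bound and the velocities will turn a closed arc into a Filippov solution, [arc_in]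
    keeps it away from the excluded set, and [arc_track] is forward uniqueness from [g 0]. Lipschitz
    bounds and finite exceptional sets are preserved by concatenation. *)
Record flow_arc (R : realType) (F : R[i] -> set R[i]) (D : set R[i])
    (g : R -> R[i]) (tau : R) : Prop := FlowArc {
  arc_gt0 : 0 < tau;
  arc_lipschitz : exists2 K : R, 0 <= K & lipschitz_path K g 0 tau;
  arc_velocity : exists2 E : set R, finite_set E &
    forall r : R, 0 < r < tau -> ~ E r -> velocity_in F g r;
  arc_in : forall r : R, 0 <= r <= tau -> D (g r);
  arc_track : forall h s, filippov_solution F h -> h s = g 0 ->
    forall r : R, 0 <= r <= tau -> h (s + r) = g r }.

Section spiral.
Variables (R : realType) (al be : R) (p z : R[i]).
Local Notation sp := (spiral al be p z).

Lemma spiral0 : sp 0 = z.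
Proof.
rewrite /spiral !mulr0 expR0 cos0 sin0 mul1r !mul0r subr0 add0r !mul1r.
by case: z => x y; apply: complex_eqP => /=; ring.
Qed.

Lemma is_derive_spiral r :
  is_derive r (1 : R) (fun r => complex.Re (sp r))
    (al * (complex.Re (sp r) - complex.Re p) -
     be * (complex.Im (sp r) - complex.Im p)) /\
  is_derive r (1 : R) (fun r => complex.Im (sp r))
    (be * (complex.Re (sp r) - complex.Re p) +
     al * (complex.Im (sp r) - complex.Im p)).
Proof.
pose E x := expR (al * x); pose C x := cos (be * x); pose S x := sin (be * x).
have dE : is_derive r (1 : R) E (al * E r).
  have := is_derive_expR_affine al 0 r; rewrite subr0.
  by rewrite (_ : (fun x => _) = E) //; apply/funext => x; rewrite subr0.
have dC : is_derive r (1 : R) C (be * - S r).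
  have := is_derive_cos_affine be 0 r; rewrite subr0.
  by rewrite (_ : (fun x => _) = C) //; apply/funext => x; rewrite subr0.
have dS : is_derive r (1 : R) S (be * C r).
  have := is_derive_sin_affine be 0 r; rewrite subr0.
  by rewrite (_ : (fun x => _) = S) //; apply/funext => x; rewrite subr0.
have dk (k : R) : is_derive r (1 : R) (fun _ : R => k) 0 by exact: is_derive_cst.
rewrite /=; split.
  (* With [z - p = u + i v], the real part uses the constants [(u, -v)], and the imaginary part
     below [(v, u)]. *)
  have H := is_derive_rotation (dk (complex.Re z - complex.Re p))
    (dk (- (complex.Im z - complex.Im p))) dE dC dS.
  have := is_deriveD (dk (complex.Re p)) H.
  rewrite [X in is_derive _ _ X _](_ : _ = (fun x => complex.Re p + expR (al * x) *
    (cos (be * x) * (complex.Re z - complex.Re p) -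
     sin (be * x) * (complex.Im z - complex.Im p)))); last first.
    by apply/funext => x; rewrite fctE /E /C /S; ring.
  by move=> H'; apply: is_derive_eq H' _; rewrite /E /C /S; ring.
have H := is_derive_rotation (dk (complex.Im z - complex.Im p))
  (dk (complex.Re z - complex.Re p)) dE dC dS.
have := is_deriveD (dk (complex.Im p)) H.
rewrite [X in is_derive _ _ X _](_ : _ = (fun x => complex.Im p + expR (al * x) *
  (sin (be * x) * (complex.Re z - complex.Re p) +
   cos (be * x) * (complex.Im z - complex.Im p)))); last first.
  by apply/funext => x; rewrite fctE /E /C /S; ring.
by move=> H'; apply: is_derive_eq H' _; rewrite /E /C /S; ring.
Qed.

Lemma spiral_bounded (t : R) : 0 <= t -> exists2 M, 0 < M & forall r, 0 <= r <= t ->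
  `|complex.Re (sp r) - complex.Re p| <= M /\
  `|complex.Im (sp r) - complex.Im p| <= M.
Proof.
move=> t0; set u := complex.Re z - complex.Re p; set v := complex.Im z - complex.Im p.
(* The exponential is monotone, so its two end values together bound it for either sign of [al]; the
   final 1 makes the bound positive. *)
exists ((expR 0 + expR (al * t)) * (`|u| + `|v| + 1)).
  by rewrite mulr_gt0 // ?addr_gt0 ?expR_gt0 // ltr_wpDl // addr_ge0.
move=> r /andP[r0 rt].
have Er : expR (al * r) <= expR 0 + expR (al * t).
  have [al0|al0] := leP 0 al.
    apply: le_trans (_ : expR (al * t) <= _); last by rewrite lerDr expR_ge0.
    by rewrite ler_expR ler_wpM2l.
  apply: le_trans (_ : expR 0 <= _); last by rewrite lerDl expR_ge0.
  by rewrite ler_expR nmulr_rle0.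
have cs (w k : R) : `|k| <= 1 -> `|k * w| <= `|w|.
  by move=> k1; rewrite normrM ler_piMl.
have H k l : `|k| <= 1 -> `|l| <= 1 -> forall y, `|y| <= `|k * u| + `|l * v| ->
   `|expR (al * r) * y| <= (expR 0 + expR (al * t)) * (`|u| + `|v| + 1).
  move=> k1 l1 y yb; rewrite normrM (ger0_norm (expR_ge0 _)).
  apply: ler_pM; rewrite ?expR_ge0 //.
  by have := cs u k k1; have := cs v l l1; lra.
have addKx (x y : R) : x + y - x = y by ring.
rewrite /spiral /= !addKx -/u -/v; split.
  apply: (H (cos (be * r)) (sin (be * r))); rewrite ?cos_max ?sin_max //.
  exact: ler_normB.
apply: (H (sin (be * r)) (cos (be * r))); rewrite ?cos_max ?sin_max //.
exact: ler_normD.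
Qed.

Lemma spiral_lipschitz (t : R) : 0 <= t ->
  exists2 K, 0 <= K & lipschitz_path K sp 0 t.
Proof.
move=> t0; have [M M0 HM] := spiral_bounded t0.
exists (`|al| * M + `|be| * M).
  by rewrite addr_ge0 // mulr_ge0 // ltW.
have lin k l x y : `|x| <= M -> `|y| <= M -> `|k * x + l * y| <= `|k| * M + `|l| * M.
  move=> xM yM; apply: le_trans (ler_normD _ _) _.
  by rewrite !normrM lerD // ler_wpM2l.
move=> u v u0 uv vt; split.
  apply: (derive_bounded_lipschitz (fun r => proj1 (is_derive_spiral r)) _ u0) => //.
  move=> r rt; have [|H1 H2] := HM r; first by lra.
  by rewrite -mulNr -(normrN be); apply: lin.
apply: (derive_bounded_lipschitz (fun r => proj2 (is_derive_spiral r)) _ u0) => //.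
move=> r rt; have [|H1 H2] := HM r; first by lra.
by rewrite addrC; apply: lin.
Qed.

(** The last hypothesis, that solutions enter the zone at once, comes from continuity when [z] is
    inside the zone and from [solution_cross] when [z] is on a discontinuity line. *)
Lemma spiral_arc (F : R[i] -> set R[i]) (D : set R[i]) (I : R -> Prop) (tau : R) :
  0 < tau ->
  (forall w v, I (complex.Im w) -> F w v <->
    complex.Re v = al * (complex.Re w - complex.Re p) -
                   be * (complex.Im w - complex.Im p) /\
    complex.Im v = be * (complex.Re w - complex.Re p) +
                   al * (complex.Im w - complex.Im p)) ->
  (forall y, I y -> exists2 e : R, 0 < e & forall y', `|y' - y| < e -> I y') ->
  (forall r, 0 < r < tau -> I (complex.Im (sp r))) ->
  (forall r, 0 <= r <= tau -> D (sp r)) ->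
  (forall g s, filippov_solution F g -> g s = z ->
    exists2 e : R, 0 < e & forall r, 0 < r < e -> I (complex.Im (g (s + r)))) ->
  flow_arc F D sp tau.
Proof.
move=> tau0 FI openI Isp Dsp enter; split => //.
- exact: spiral_lipschitz (ltW tau0).
- exists set0 => // r rtau _.
  exists ((al * (complex.Re (sp r) - complex.Re p) -
           be * (complex.Im (sp r) - complex.Im p)) +i*
          (be * (complex.Re (sp r) - complex.Re p) +
           al * (complex.Im (sp r) - complex.Im p))).
    by apply/FI => //; exact: Isp.
  exact: is_derive_spiral.
- move=> h s solh; rewrite spiral0 => hs r rtau; rewrite -hs.
  apply: (solution_track (I := I) solh _ openI (tau := tau)) => //.
  + by move=> w v Iw /FI; apply.
  + by move=> q; rewrite hs; exact: Isp.
  + exact: enter.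
Qed.

End spiral.

(** * Polar coordinates, arcs and half turns *)

(** The angle stays below [pi] because a point of the axis has [u > 0], so a positive angle remains
    before the axis is met on the left. The last clause makes the return exact for points of the
    section. *)
Lemma polar_upper (R : realType) (u v : R) : 0 <= v -> (v = 0 -> 0 < u) ->
  exists rho th : R, [/\ 0 < rho, 0 <= th < pi, u = rho * cos th,
    v = rho * sin th & v = 0 -> th = 0 /\ rho = u].
Proof.
move=> v0 uv; have [vE|vneq0] := eqVneq v 0.
  exists u, 0; rewrite cos0 sin0 mulr1 mulr0 lexx pi_gt0.
  by split => //; exact: uv.
have {uv}v0 : 0 < v by rewrite lt_neqAle eq_sym vneq0.
pose rho := Num.sqrt (u ^+ 2 + v ^+ 2).
have v20 : 0 < v ^+ 2 by rewrite exprn_gt0.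
have rho2 : rho ^+ 2 = u ^+ 2 + v ^+ 2 by rewrite sqr_sqrtr // addr_ge0 ?sqr_ge0.
have rho0 : 0 < rho by rewrite sqrtr_gt0 ltr_wpDl // sqr_ge0.
have /andP[u1 u2] : -1 < u / rho < 1.
  rewrite -ltr_norml normrM normfV (gtr0_norm rho0) ltr_pdivrMr // mul1r.
  by rewrite -ltr_sqr ?nnegrE ?(ltW rho0) // real_normK ?num_real // rho2; lra.
have u12 : -1 <= u / rho <= 1 by rewrite !ltW.
exists rho, (acos (u / rho)); split => //.
- by rewrite acos_ge0 //= acos_ltpi // u1 ltW.
- by rewrite acosK ?in_itv //= mulrC divfK // gt_eqF.
- rewrite sin_acos // (_ : 1 - (u / rho) ^+ 2 = (v / rho) ^+ 2); last first.
    rewrite !expr_div_n (_ : v ^+ 2 = rho ^+ 2 - u ^+ 2); last by rewrite rho2; ring.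
    by field; rewrite gt_eqF.
  by rewrite sqrtr_sqr ger0_norm ?divr_ge0 ?ltW // mulrC divfK // gt_eqF.
- by move=> vE; rewrite vE eqxx in vneq0.
Qed.

(** Both angles are arcsines, hence in the range where the sine increases: the height grows from [v]
    and meets 1 first at [phi]. The left half of the strip is treated by this lemma after a change
    of sign. *)
Lemma polar_right (R : realType) (u v : R) :
  0 < u -> -1 <= v -> v < 1 -> 1 < u ^+ 2 + v ^+ 2 ->
  exists rho psi phi : R, [/\ rho ^+ 2 = u ^+ 2 + v ^+ 2, u = rho * cos psi,
    v = rho * sin psi, psi < phi &
    (forall x, psi < x < phi -> -1 < rho * sin x < 1) /\
    rho * sin phi = 1 /\ rho * cos phi = Num.sqrt (u ^+ 2 + v ^+ 2 - 1)].
Proof.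
move=> u0 v1 v2 uv.
pose rho := Num.sqrt (u ^+ 2 + v ^+ 2).
have rho2 : rho ^+ 2 = u ^+ 2 + v ^+ 2 by rewrite sqr_sqrtr // addr_ge0 ?sqr_ge0.
have rho1 : 1 < rho by rewrite -sqrtr1 ltr_sqrt //; lra.
have rho0 : 0 < rho by lra.
have rhoK x : rho * (x / rho) = x by rewrite mulrC divfK // gt_eqF.
have ir : 1 / rho < 1 by rewrite ltr_pdivrMr // mul1r.
have lev : - (1 / rho) <= v / rho by rewrite -mulNr ler_pM2r ?invr_gt0.
have ltv : v / rho < 1 / rho by rewrite ltr_pM2r ?invr_gt0.
have I1 : -1 <= 1 / rho <= 1 by apply/andP; split; lra.
have I2 : -1 <= v / rho <= 1 by apply/andP; split; lra.
have J1 : asin (1 / rho) \in `[- (pi / 2), pi / 2].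
  by rewrite in_itv /= asin_geNpi2 // asin_lepi2.
have J2 : asin (v / rho) \in `[- (pi / 2), pi / 2].
  by rewrite in_itv /= asin_geNpi2 // asin_lepi2.
exists rho, (asin (v / rho)), (asin (1 / rho)); split => //.
- rewrite cos_asin // (_ : 1 - (v / rho) ^+ 2 = (u / rho) ^+ 2); last first.
    rewrite !expr_div_n (_ : u ^+ 2 = rho ^+ 2 - v ^+ 2); last by rewrite rho2; ring.
    by field; rewrite gt_eqF.
  by rewrite sqrtr_sqr ger0_norm ?divr_ge0 ?ltW // rhoK.
- by rewrite asinK ?in_itv //= rhoK.
- by rewrite -ltr_sin // !asinK ?in_itv.
split; last split.
- move=> x /andP[x1 x2]; have J3 : x \in `[- (pi / 2), pi / 2].
    by move: J1 J2; rewrite !in_itv /= => /andP[? ?] /andP[? ?]; apply/andP; lra.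
  move: x1 x2; rewrite -ltr_sin // asinK ?in_itv // => x1.
  rewrite -ltr_sin // asinK ?in_itv // => x2.
  have : rho * (v / rho) < rho * sin x by rewrite ltr_pM2l.
  have : rho * sin x < rho * (1 / rho) by rewrite ltr_pM2l.
  by rewrite !rhoK => ? ?; apply/andP; lra.
- by rewrite asinK ?in_itv //= rhoK.
- rewrite cos_asin // -{1}(ger0_norm (ltW rho0)) -sqrtr_sqr -sqrtrM ?sqr_ge0 //.
  by congr Num.sqrt; rewrite mulrBr -exprMn rhoK mulr1 rho2 expr1n.
Qed.

(** What is removed is the closed unit disc and the closed unstable sliding segments, [[-x1, 0]] on
    the upper line and [[0, x0]] on the lower one; at their ends one of the adjacent fields has zero
    vertical component. *)
Definition outside (R : realType) (x0 x1 : R) : set R[i] :=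
  [set z | [/\ 1 < complex.Re z ^+ 2 + complex.Im z ^+ 2,
    complex.Im z = 1 -> complex.Re z < - x1 \/ 0 < complex.Re z &
    complex.Im z = -1 -> complex.Re z < 0 \/ x0 < complex.Re z]].

Lemma outsideN (R : realType) (x0 x1 : R) (z : R[i]) :
  outside x0 x1 z -> outside x1 x0 (- z).
Proof.
case: z => x y [/= h1 h2 h3]; split => /=; first by rewrite !sqrrN.
  move=> /eqP; rewrite eqr_oppLR => /eqP /h3; rewrite oppr_gt0 ltrN2.
  by move=> [?|?]; [right|left].
move=> /eqP; rewrite eqr_opp => /eqP /h2; rewrite oppr_lt0 ltrNr.
by move=> [?|?]; [right|left].
Qed.

Lemma arcN (R : realType) (a b c d x0 x1 tau : R) (g : R -> R[i]) :
  flow_arc (pws_field a b c d x0 x1) (outside x0 x1) g tau ->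
  flow_arc (pws_field c d a b x1 x0) (outside x1 x0) (fun r => - g r) tau.
Proof.
move=> [tau0 [K K0 lip] [E cE vel] inD track].
have ReN : (fun r => complex.Re (- g r)) = - (fun r => complex.Re (g r)).
  by apply/funext => r; rewrite fctE; case: (g r).
have ImN : (fun r => complex.Im (- g r)) = - (fun r => complex.Im (g r)).
  by apply/funext => r; rewrite fctE; case: (g r).
split => //.
- exists K => // u v u0 uv vtau; have := lip u v u0 uv vtau.
  case: (g u) (g v) => [p q] [p' q'] /=.
  by rewrite -!opprD !normrN.
- exists E => // r rtau nE; have [v Fv [dr di]] := vel r rtau nE.
  exists (- v); first exact: pws_fieldN.
  rewrite ReN ImN; case: v {Fv} dr di => p q /= dr di.
  by split; exact: is_deriveN.
- by move=> r rtau; exact/outsideN/inD.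
- move=> h s /pws_solutionN solh hs r rtau.
  rewrite -(track (fun t => - h t) s) ?opprK //.
  by rewrite hs opprK.
Qed.

Definition path_cat (R : realType) (t1 : R) (g1 g2 : R -> R[i]) (r : R) : R[i] :=
  if r <= t1 then g1 r else g2 (r - t1).

Lemma velocity_in_shift (R : realType) (F : R[i] -> set R[i]) (g h : R -> R[i])
  (r k : R) : (\forall x \near r, g (x - k) = h x) ->
  velocity_in F g (r - k) -> velocity_in F h r.
Proof.
move=> gh [v Fv [dr di]]; exists v; first by rewrite -(nbhs_singleton gh).
have shift (f : R -> R) l : is_derive (r - k) (1 : R) f l ->
    is_derive r (1 : R) (fun x => f (x - k)) l.
  move=> fl; have := @is_derive_comp_affine R 1 k f r l.
  rewrite !mul1r => /(_ fl).
  by rewrite (_ : (fun x => _) = (fun x => f (x - k))) //;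
    apply/funext => x; rewrite mul1r.
by split; [apply: near_eq_is_derive (shift _ _ dr)|
  apply: near_eq_is_derive (shift _ _ di)]; near=> x; rewrite (near gh x).
Unshelve. all: by end_near. Qed.

Lemma arc_cat (R : realType) (F : R[i] -> set R[i]) (D : set R[i])
  (g1 g2 : R -> R[i]) (t1 t2 : R) :
  flow_arc F D g1 t1 -> flow_arc F D g2 t2 -> g1 t1 = g2 0 ->
  flow_arc F D (path_cat t1 g1 g2) (t1 + t2).
Proof.
move=> [t10 [K1 K10 lip1] [E1 cE1 vel1] in1 track1].
move=> [t20 [K2 K20 lip2] [E2 cE2 vel2] in2 track2] g12.
have catl r : r <= t1 -> path_cat t1 g1 g2 r = g1 r by rewrite /path_cat => ->.
have catr r : t1 <= r -> path_cat t1 g1 g2 r = g2 (r - t1).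
  rewrite le_eqVlt => /orP[/eqP <-|]; first by rewrite catl // subrr.
  by rewrite /path_cat ltNge => /negbTE ->.
split.
- by rewrite addr_gt0.
- exists (K1 + K2); first by rewrite addr_ge0.
  have lip1' u v : 0 <= u -> u <= v -> v <= t1 ->
    `|complex.Re (g1 v) - complex.Re (g1 u)| <= (K1 + K2) * (v - u) /\
    `|complex.Im (g1 v) - complex.Im (g1 u)| <= (K1 + K2) * (v - u).
    move=> u0 uv vt; have [H1 H2] := lip1 u v u0 uv vt.
    have : 0 <= K2 * (v - u) by rewrite mulr_ge0 // subr_ge0.
    by split; lra.
  have lip2' u v : t1 <= u -> u <= v -> v <= t1 + t2 ->
    `|complex.Re (g2 (v - t1)) - complex.Re (g2 (u - t1))| <= (K1 + K2) * (v - u) /\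
    `|complex.Im (g2 (v - t1)) - complex.Im (g2 (u - t1))| <= (K1 + K2) * (v - u).
    move=> u0 uv vt; have [||| H1 H2] := lip2 (u - t1) (v - t1); [lra..|].
    have : 0 <= K1 * (v - u) by rewrite mulr_ge0 // subr_ge0.
    by split; lra.
  move=> u v u0 uv vt; have [vt1|t1v] := leP v t1.
    by rewrite !catl //; [apply: lip1'|lra].
  have [ut1|t1u] := leP u t1; last by rewrite !catr; [apply: lip2'|..]; lra.
  have [|||H1 H2] := lip1' u t1; [lra..|].
  have [|||H3 H4] := lip2' t1 v; [lra..|].
  rewrite subrr -g12 in H3 H4.
  rewrite (catl u) // (catr v (ltW t1v)).
  split.
    have := ler_normD (complex.Re (g2 (v - t1)) - complex.Re (g1 t1))
      (complex.Re (g1 t1) - complex.Re (g1 u)).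
    by rewrite addrA subrK; lra.
  have := ler_normD (complex.Im (g2 (v - t1)) - complex.Im (g1 t1))
    (complex.Im (g1 t1) - complex.Im (g1 u)).
  by rewrite addrA subrK; lra.
(* The junction time joins the exceptional set, since the velocity may jump there. *)
- exists (E1 `|` ([set t1] `|` (fun x => x + t1) @` E2)).
    by rewrite !finite_setU; split => //; split => //; exact: finite_image.
  move=> r /andP[r0 rt] nE; have [rt1|t1r|E] := ltgtP r t1.
  + apply: (@velocity_in_shift _ _ g1 _ _ 0).
      near=> x; rewrite subr0 catl //.
      by apply/ltW; near: x; exact: lt_nbhsl.
    rewrite subr0; apply: vel1; first by rewrite r0.
    by move=> E; apply: nE; left.
  + apply: (@velocity_in_shift _ _ g2 _ _ t1).
      near=> x; rewrite catr //.
      by apply/ltW; near: x; exact: lt_nbhsr.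
    apply: vel2; first by apply/andP; split; lra.
    by move=> E; apply: nE; right; right; exists (r - t1); rewrite ?subrK.
  + by exfalso; apply: nE; right; left.
- move=> r /andP[r0 rt]; have [rt1|t1r] := leP r t1.
    by rewrite catl //; apply: in1; rewrite r0.
  by rewrite catr ?ltW //; apply: in2; apply/andP; split; lra.
- move=> h s solh; rewrite catl ?ltW // => hs r /andP[r0 rt].
  have [rt1|t1r] := leP r t1.
    by rewrite catl //; apply: track1 => //; rewrite r0.
  rewrite catr ?ltW // -(track2 h (s + t1)) //.
  + by congr h; ring.
  + by rewrite -g12; apply: track1 => //; rewrite lexx ltW.
  + by apply/andP; split; lra.
Unshelve. all: by end_near. Qed.

Lemma upper_arc (R : realType) (a b c d x0 x1 : R) (z : R[i]) :
  0 < b -> 0 < x1 ->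
  1 < complex.Im z \/ complex.Im z = 1 /\ 0 < complex.Re z ->
  exists tau g k, [/\ flow_arc (pws_field a b c d x0 x1) (outside x0 x1) g tau, g 0 = z, 0 < k,
    g tau = (- x1 - k) +i* 1 &
    complex.Im z = 1 -> k = expR (a * (pi / b)) * (complex.Re z + x1)].
Proof.
move=> b0 x10 hz; pose p : R[i] := (- x1) +i* 1.
have [||rho [th [rho0 /andP[th0 thpi] uE vE th1]]] :=
    @polar_upper R (complex.Re z + x1) (complex.Im z - 1).
- by case: hz => [|[->]]; lra.
- move=> /eqP; rewrite subr_eq0 => /eqP vE; case: hz => [|[_ xpos]]; first by rewrite vE ltxx.
  exact: addr_gt0.
(* The time needed at angular speed [b] to turn around the focus from the angle [th] to [pi]. *)
pose tau := (pi - th) / b.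
have tau0 : 0 < tau by rewrite divr_gt0 // subr_gt0.
have btau : b * tau = pi - th by rewrite /tau mulrC divfK // gt_eqF.
have ReE r : complex.Re (spiral a b p z r) =
    - x1 + expR (a * r) * (rho * cos (b * r + th)).
  by rewrite /= opprK uE vE cosD; ring.
have ImE r : complex.Im (spiral a b p z r) =
    1 + expR (a * r) * (rho * sin (b * r + th)).
  by rewrite /= opprK uE vE sinD; ring.
have Iin r : 0 < r < tau -> 1 < complex.Im (spiral a b p z r).
  move=> /andP[r0 rt]; rewrite ImE ltrDl !mulr_gt0 ?expR_gt0 //.
  have : 0 < b * r by rewrite mulr_gt0.
  have : b * r < b * tau by rewrite ltr_pM2l.
  by rewrite btau => ? ?; apply: sin_gt0_pi; apply/andP; split; lra.
have end_ : spiral a b p z tau = (- x1 - expR (a * tau) * rho) +i* 1.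
  apply: complex_eqP; first by rewrite ReE btau subrK cospi /=; ring.
  by rewrite ImE btau subrK sinpi /=; ring.
have k0 : 0 < expR (a * tau) * rho by rewrite mulr_gt0 ?expR_gt0.
exists tau, (spiral a b p z), (expR (a * tau) * rho); split => //.
- apply: (@spiral_arc _ _ _ _ _ _ _ (fun y => 1 < y)) => //.
  + by move=> w v Iw; rewrite (pws_field_up a b c d x0 x1 v Iw) /p /= opprK.
  + move=> y y1; exists (y - 1); first by rewrite subr_gt0.
    by move=> y'; rewrite ltr_norml => /andP[]; lra.
  + move=> r /andP[]; rewrite le_eqVlt => /orP[/eqP <- _|r0].
      rewrite spiral0; case: hz => [y1|[y1 xpos]]; split.
      * have := sqr_ge0 (complex.Re z); suff : 1 < complex.Im z ^+ 2 by lra.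
        by rewrite expr_gt1 // ltW // (lt_trans ltr01).
      * lra.
      * lra.
      * by rewrite y1; have := exprn_gt0 2 xpos; lra.
      * by right.
      * lra.
    rewrite le_eqVlt => /orP[/eqP ->|rt].
      rewrite end_; split => /=; [|by left; lra|lra].
      rewrite -sqrrN expr1n; suff : 0 < (- (- x1 - expR (a * tau) * rho)) ^+ 2 by lra.
      by rewrite exprn_gt0 //; lra.
    have y1 := Iin r; rewrite r0 rt in y1; have {}y1 := y1 isT.
    split; [|lra|lra].
    have := sqr_ge0 (complex.Re (spiral a b p z r)).
    suff : 1 < complex.Im (spiral a b p z r) ^+ 2 by lra.
    by rewrite expr_gt1 // ltW // (lt_trans ltr01).
  + move=> g s solg gs; case: hz => [y1|[y1 xpos]].
      have [|k kpos Hk] := @solution_near R _ g s (complex.Im z - 1) solg.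
        by rewrite subr_gt0.
      exists k => // r /andP[r0 rk]; have [|_] := Hk (s + r).
        by rewrite (_ : s + r - s = r) ?gtr0_norm //; ring.
      by rewrite gs ltr_norml => /andP[]; lra.
    have [|||e e0 He] := @solution_cross R a b c d x0 x1 1 g s b0 (expr1n _ _) solg.
    * by rewrite gs.
    * by rewrite gs mul1r.
    * by rewrite gs mul1r; lra.
    by exists e => // r /He[_]; lra.
- exact: spiral0.
- move=> y1; have [|thE ->] := th1; first by rewrite y1 subrr.
  by rewrite /tau thE subr0.
Qed.

(** The rotation preserves the modulus, which determines the abscissa at height -1 up to sign; the
    left half-plane is not left, whence the sign. *)
Lemma middle_arc (R : realType) (a b c d x0 x1 : R) (z : R[i]) :
  0 < b -> 0 < x1 ->
  complex.Im z = 1 /\ complex.Re z < - x1 \/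
  [/\ -1 < complex.Im z < 1, complex.Re z < 0 &
      1 < complex.Re z ^+ 2 + complex.Im z ^+ 2] ->
  exists tau g, [/\ flow_arc (pws_field a b c d x0 x1) (outside x0 x1) g tau, g 0 = z &
    g tau = (- Num.sqrt (complex.Re z ^+ 2 + complex.Im z ^+ 2 - 1)) +i* (-1)].
Proof.
move=> b0 x10 hz.
have x0' : complex.Re z < 0 by case: hz => [[]|[]]; lra.
have n1 : 1 < complex.Re z ^+ 2 + complex.Im z ^+ 2.
  case: hz => [[-> _]|[]//]; suff : 0 < complex.Re z ^+ 2 by lra.
  by rewrite -sqrrN exprn_gt0 // oppr_gt0.
have [||||rho [psi [phi [rho2 uE vE psiphi [Hin [sphi cphi]]]]]] :=
  @polar_right R (- complex.Re z) (- complex.Im z).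
- by rewrite oppr_gt0.
- by case: hz => [[-> _]|[/andP[]]]; lra.
- by case: hz => [[-> _]|[/andP[]]]; lra.
- by rewrite !sqrrN.
rewrite !sqrrN in rho2 cphi.
pose tau := phi - psi; have tau0 : 0 < tau by rewrite subr_gt0.
have ReE r : complex.Re (spiral 0 1 0 z r) = - (rho * cos (r + psi)).
  rewrite /= !subr0 mul0r expR0 !mul1r add0r -(opprK (complex.Re z)).
  by rewrite -(opprK (complex.Im z)) uE vE cosD; ring.
have ImE r : complex.Im (spiral 0 1 0 z r) = - (rho * sin (r + psi)).
  rewrite /= !subr0 mul0r expR0 !mul1r add0r -(opprK (complex.Re z)).
  by rewrite -(opprK (complex.Im z)) uE vE sinD; ring.
have Iin r : 0 < r < tau -> -1 < complex.Im (spiral 0 1 0 z r) < 1.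
  move=> /andP[r0 rt]; rewrite ImE.
  have /andP[] := Hin (r + psi) ltac:(rewrite /tau in rt; apply/andP; split; lra).
  by move=> ? ?; apply/andP; split; lra.
have end_ : spiral 0 1 0 z tau =
    (- Num.sqrt (complex.Re z ^+ 2 + complex.Im z ^+ 2 - 1)) +i* (-1).
  by apply: complex_eqP; [rewrite ReE | rewrite ImE];
    rewrite /tau subrK ?cphi ?sphi.
exists tau, (spiral 0 1 0 z); split => //; last exact: spiral0.
apply: (@spiral_arc _ _ _ _ _ _ _ (fun y => -1 < y < 1)) => //.
- move=> w v Iw; rewrite (pws_field_mid a b c d x0 x1 v Iw) /= !subr0.
  by rewrite !mul0r !mul1r add0r addr0.
- move=> y /andP[y1 y2]; exists (Num.min (y + 1) (1 - y)).
    by rewrite lt_min; apply/andP; split; lra.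
  move=> y'; rewrite lt_min !ltr_norml => /andP[/andP[? ?] /andP[? ?]].
  by apply/andP; split; lra.
- move=> r /andP[r0 rt]; split.
  + rewrite ReE ImE !sqrrN !exprMn -mulrDr cos2Dsin2 mulr1 rho2 //.
  + move: r0; rewrite le_eqVlt => /orP[/eqP <-|r0].
      by rewrite spiral0; case: hz => [[_ ?] _|[/andP[]]]; [left|lra].
    move: rt; rewrite le_eqVlt => /orP[/eqP ->|rt]; first by rewrite end_ /=; lra.
    by have /andP[] := Iin r ltac:(by rewrite r0 rt); lra.
  + move: rt; rewrite le_eqVlt => /orP[/eqP ->|rt].
      by rewrite end_ /= => _; left; rewrite oppr_lt0 sqrtr_gt0 subr_gt0.
    move: r0; rewrite le_eqVlt => /orP[/eqP <-|r0].
      by rewrite spiral0; case: hz => [[-> _]|[/andP[]]]; lra.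
    by have /andP[] := Iin r ltac:(by rewrite r0 rt); lra.
- move=> g s solg gs; case: hz => [[y1 xneg]|[/andP[y1 y2] _ _]].
    have [||||e e0 He] := @solution_cross R a b c d x0 x1 (-1) g s b0 _ solg.
    * by rewrite sqrrN expr1n.
    * by rewrite gs.
    * by rewrite gs mulN1r oppr_gt0.
    * by rewrite gs mulN1r oppr_gt0; lra.
    by exists e => // r /He[? ?]; apply/andP; split; lra.
  pose h := Num.min (complex.Im z + 1) (1 - complex.Im z).
  have h0 : 0 < h by rewrite lt_min; apply/andP; split; lra.
  have [k kpos Hk] := solution_near s solg h0.
  exists k => // r /andP[r0 rk]; have [|_] := Hk (s + r).
    by rewrite (_ : s + r - s = r) ?gtr0_norm //; ring.
  rewrite gs /h lt_min !ltr_norml => /andP[/andP[? ?] /andP[? ?]].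
  by apply/andP; split; lra.
Qed.

(** The endpoint is given through its opposite, which is again a point of the section: the lower
    half turn is the same lemma for the mirrored parameters. *)
Lemma half_turn (R : realType) (a b c d x0 x1 : R) (z : R[i]) :
  0 < b -> 0 < x1 ->
  1 < complex.Im z \/ complex.Im z = 1 /\ 0 < complex.Re z ->
  exists tau g k, [/\ flow_arc (pws_field a b c d x0 x1) (outside x0 x1) g tau, g 0 = z, 0 < k,
    - g tau = (x1 + k) +i* 1 &
    complex.Im z = 1 -> k = expR (a * (pi / b)) * (complex.Re z + x1)].
Proof.
move=> b0 x10 /(upper_arc a c d x0 b0 x10)[t1 [g1 [k [arc1 g10 k0 g1t kE]]]].
have [|t2 [g2 [arc2 g20 g2t]]] := @middle_arc R a b c d x0 x1 (g1 t1) b0 x10.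
  by rewrite g1t /=; left; split => //; lra.
exists (t1 + t2), (path_cat t1 g1 g2), k; split => //.
- exact: arc_cat.
- by rewrite /path_cat ltW // (arc_gt0 arc1).
(* Both ends of the middle arc have height of absolute value 1, so conservation of the modulus keeps
   the abscissa [- x1 - k]. *)
- rewrite /path_cat leNgt ltrDl (arc_gt0 arc2) /= addrC addKr g2t g1t /=.
  rewrite expr1n addrK -(sqrrN (- x1 - k)) sqrtr_sqr ger0_norm; last by lra.
  by apply: complex_eqP => /=; ring.
Qed.

(** Composite of the two half turns [x -> x1 + exp(a pi / b) (x + x1)] and
    [y -> x0 + exp(c pi / d) (y + x0)]. *)
Definition return_map (R : realType) (a b c d x0 x1 x : R) : R :=
  x0 + expR (c * (pi / d)) * (x1 + expR (a * (pi / b)) * (x + x1) + x0).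

Lemma full_turn (R : realType) (a b c d x0 x1 x : R) :
  a < 0 -> c < 0 -> 0 < b -> 0 < d -> 0 < x0 -> 0 < x1 -> 0 < x ->
  exists tau g, [/\ flow_arc (pws_field a b c d x0 x1) (outside x0 x1) g tau,
    g 0 = x +i* 1 & g tau = return_map a b c d x0 x1 x +i* 1].
Proof.
move=> a0 c0 b0 d0 x00 x10 xpos.
have [|t1 [g1 [k [arc1 g10 k0 g1t kE]]]] :=
    @half_turn R a b c d x0 x1 (x +i* 1) b0 x10; first by right.
have [|t2 [g2 [l [arc2 g20 l0 g2t lE]]]] :=
    @half_turn R c d a b x1 x0 (- g1 t1) d0 x00.
  by rewrite g1t; right => /=; split => //; lra.
exists (t1 + t2), (path_cat t1 g1 (fun r => - g2 r)); split.
- by apply: arc_cat arc1 (arcN arc2) _; rewrite g20 opprK.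
- by rewrite /path_cat ltW // (arc_gt0 arc1).
- rewrite /path_cat leNgt ltrDl (arc_gt0 arc2) /= addrC addKr g2t.
  by rewrite lE ?g1t //= kE.
Qed.

(** * Periodic extension of a closed arc *)

Section periodic.
Variables (R : realType) (T : Type) (g : R -> T) (tau : R).
Hypothesis gper : forall t, g (t + tau) = g t.

Lemma periodic_shift (n : int) (t : R) : g (t + n%:~R * tau) = g t.
Proof.
have H (m : nat) s : g (s + m%:R * tau) = g s.
  elim: m s => [|m IH] s; first by rewrite mul0r addr0.
  by rewrite -natr1 mulrDl mul1r addrA gper IH.
case: n => n; first exact: H.
by rewrite -[t in RHS](subrK (n.+1%:R * tau)) H NegzE mulrNz mulNr.
Qed.

Lemma periodic_reduce (t : R) : 0 < tau ->
  exists2 t', 0 <= t' <= tau & g t' = g t.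
Proof.
move=> tau0; exists (t - (Num.floor (t / tau))%:~R * tau); last first.
  by have := periodic_shift (- Num.floor (t / tau)) t; rewrite mulrNz mulNr.
have /andP[f1 f2] := floor_itv (t / tau).
rewrite ler_pdivlMr // in f1; rewrite ltr_pdivrMr // in f2.
rewrite intrD mulrDl mul1r in f2.
by apply/andP; split; lra.
Qed.

End periodic.

Definition periodic_ext (R : realType) (T : Type) (g : R -> T) (tau t : R) : T :=
  g (t - (Num.floor (t / tau))%:~R * tau).

Section periodic_ext.
Variables (R : realType) (T : Type) (g : R -> T) (tau : R).
Hypotheses (tau0 : 0 < tau) (gclosed : g tau = g 0).
Local Notation h := (periodic_ext g tau).

Lemma periodic_extP (t : R) : h (t + tau) = h t.
Proof.
rewrite /periodic_ext mulrDl divff ?gt_eqF // floorDrz ?rpred1 // floor1.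
by congr g; rewrite intrD; ring.
Qed.

(** The right end of the period, where the floor jumps, is included thanks to [g tau = g 0];
    adjacent pieces therefore share their endpoint. *)
Lemma periodic_ext_piece (n : int) (t : R) :
  n%:~R * tau <= t <= (n + 1)%:~R * tau -> h t = g (t - n%:~R * tau).
Proof.
move=> /andP[t1]; rewrite le_eqVlt => /orP[/eqP ->|t2]; last first.
  rewrite /periodic_ext (_ : Num.floor (t / tau) = n) //; apply: floor_def.
  by rewrite ler_pdivlMr // ltr_pdivrMr // t1.
rewrite /periodic_ext mulfK ?gt_eqF // intrKfloor subrr -gclosed.
by congr g; rewrite intrD; ring.
Qed.

(** Strict on the left, as [periodic_ext_right] is on the right: the two pieces obtained at [t]
    together cover a neighbourhood of [t], even at a multiple of [tau]. *)
Lemma periodic_ext_left (t : R) : exists n : int,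
  n%:~R * tau < t <= (n + 1)%:~R * tau.
Proof.
exists (Num.ceil (t / tau) - 1); have /andP[c1 c2] := ceil_itv (t / tau).
by rewrite subrK -ltr_pdivlMr // -ler_pdivrMr // c1.
Qed.

Lemma periodic_ext_right (t : R) : exists n : int,
  n%:~R * tau <= t < (n + 1)%:~R * tau.
Proof.
exists (Num.floor (t / tau)); have /andP[c1 c2] := floor_itv (t / tau).
by rewrite -ler_pdivlMr // -ltr_pdivrMr // c1.
Qed.

End periodic_ext.

Section closed_arc.
Variables (R : realType) (F : R[i] -> set R[i]) (D : set R[i]).
Variables (g : R -> R[i]) (tau : R).
Hypotheses (arcg : flow_arc F D g tau) (gclosed : g tau = g 0).
Local Notation h := (periodic_ext g tau).

Lemma closed_arc_lipschitz : exists2 K : R, 0 <= K &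
  forall s t, lipschitz_path K h s t.
Proof.
have tau0 := arc_gt0 arcg; have [K K0 lip] := arc_lipschitz arcg.
exists K => // _ _ s t _ st _.
have piece (n : int) u v : n%:~R * tau <= u -> u <= v -> v <= (n + 1)%:~R * tau ->
    `|complex.Re (h v) - complex.Re (h u)| <= K * (v - u) /\
    `|complex.Im (h v) - complex.Im (h u)| <= K * (v - u).
  move=> nu uv vn.
  rewrite !(periodic_ext_piece tau0 gclosed (n := n)); last 2 first.
  - by apply/andP; split; lra.
  - by apply/andP; split; lra.
  rewrite intrD mulrDl mul1r in vn.
  have [|||H1 H2] := lip (u - n%:~R * tau) (v - n%:~R * tau); [lra..|].
  by split; lra.
apply: (interval_induction (P := fun u v =>
  `|complex.Re (h v) - complex.Re (h u)| <= K * (v - u) /\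
  `|complex.Im (h v) - complex.Im (h u)| <= K * (v - u))) => //.
  move=> u v w _ _ [H1 H2] [H3 H4]; split.
    have := ler_normD (complex.Re (h w) - complex.Re (h v))
      (complex.Re (h v) - complex.Re (h u)).
    by rewrite addrA subrK; lra.
  have := ler_normD (complex.Im (h w) - complex.Im (h v))
    (complex.Im (h v) - complex.Im (h u)).
  by rewrite addrA subrK; lra.
move=> r _; have [n /andP[n1 n2]] := periodic_ext_left tau0 r.
have [m /andP[m1 m2]] := periodic_ext_right tau0 r.
exists (Num.min (r - n%:~R * tau) ((m + 1)%:~R * tau - r)).
  by rewrite lt_min !subr_gt0 n1.
move=> u v _ _ ru ur rv vr.
have nu : n%:~R * tau <= u.
  have : r - n%:~R * tau >= Num.min (r - n%:~R * tau) ((m + 1)%:~R * tau - r).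
    by rewrite ge_min lexx.
  by lra.
have vm : v <= (m + 1)%:~R * tau.
  have : (m + 1)%:~R * tau - r >= Num.min (r - n%:~R * tau) ((m + 1)%:~R * tau - r).
    by rewrite ge_min lexx orbT.
  by lra.
have [H1 H2] := piece n u r nu ur n2; have [H3 H4] := piece m r v m1 rv vm.
split.
  have := ler_normD (complex.Re (h v) - complex.Re (h r))
    (complex.Re (h r) - complex.Re (h u)).
  by rewrite addrA subrK; lra.
have := ler_normD (complex.Im (h v) - complex.Im (h r))
  (complex.Im (h r) - complex.Im (h u)).
by rewrite addrA subrK; lra.
Qed.

Lemma closed_arc_solution : filippov_solution F h.
Proof.
have tau0 := arc_gt0 arcg; split.
  have [K K0 lip] := closed_arc_lipschitz.
  move=> s t; split; apply: (@ac_lipschitz _ _ _ _ K) => u v su uv vt.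
    by have [] := lip s t u v su uv vt.
  by have [] := lip s t u v su uv vt.
have [E fE vel] := arc_velocity arcg.
(* Translates of the exceptional times and of the junction time 0 by all multiples of the period, a
   countable set. *)
pose N := \bigcup_(n in [set: int]) ((fun x => x + n%:~R * tau) @` (E `|` [set 0])).
have cN : countable N.
  apply: bigcup_countable => // n _; apply: finite_set_countable.
  by apply: finite_image; rewrite finite_setU.
exists N; split; [|exact: countable_lebesgue_measure0|].
  by apply: countable_measurable.
move=> t /= nt; apply: contrapT => nN; apply: nt.
have [n /andP[n1 n2]] := periodic_ext_right tau0 t.
have nNt x : (E `|` [set 0]) x -> x <> t - n%:~R * tau.
  by move=> Ex xE; apply: nN; exists n => //; exists x => //; rewrite xE subrK.
have {}n1 : n%:~R * tau < t.
  rewrite lt_neqAle n1 andbT; apply/eqP => nE; apply: (nNt 0); first by right.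
  by rewrite nE subrr.
have n3 := n2; rewrite intrD mulrDl mul1r in n3.
change (velocity_in F h t); apply: (@velocity_in_shift _ _ g _ _ (n%:~R * tau)).
  near=> x; rewrite (periodic_ext_piece tau0 gclosed (n := n)) //.
  apply/andP; split; apply/ltW; near: x; [exact: lt_nbhsr|exact: lt_nbhsl].
apply: vel; first by apply/andP; split; lra.
by move=> Et; apply: (nNt _ (or_introl Et)).
Unshelve. all: by end_near. Qed.

(** By [arc_track] the solution is back at [g 0] after each period, so uniqueness can be restarted
    there. *)
Lemma closed_arc_track (f : R -> R[i]) (s : R) :
  filippov_solution F f -> f s = g 0 -> forall r, 0 <= r -> f (s + r) = h r.
Proof.
move=> solf fs; have tau0 := arc_gt0 arcg.
have H (n : nat) : f (s + n%:R * tau) = g 0.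
  elim: n => [|n IH]; first by rewrite mul0r addr0.
  rewrite -natr1 mulrDl mul1r addrA (arc_track arcg solf IH) ?lexx ?ltW //.
move=> r r0; have [n /andP[n1 n2]] := periodic_ext_right tau0 r.
have n0 : 0 <= n.
  rewrite -ltzD1 -(ltr0z R) -(pmulr_lgt0 _ tau0); lra.
case: n n0 n1 n2 => // n _ n1 n2.
rewrite (periodic_ext_piece tau0 gclosed (n := n)) ?n1 ?ltW //.
rewrite -(arc_track arcg solf (H n)); first by congr f; ring.
rewrite intrD mulrDl mul1r in n2.
by apply/andP; split; lra.
Qed.

End closed_arc.

(** * Tubes around orbits and access to the section *)

(** Interval induction applies because radii can be shrunk to a common minimum; locally half of the
    radius at [g r] covers the motion of [g] and half the distance to [w]. *)
Lemma solution_tube (R : realType) (F : R[i] -> set R[i]) (g : R -> R[i])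
    (W : set R[i]) (s t : R) : s <= t -> filippov_solution F g ->
  (forall z, W z -> exists2 e : R, 0 < e & forall w,
     `|complex.Re w - complex.Re z| < e -> `|complex.Im w - complex.Im z| < e ->
     W w) ->
  (forall r, s <= r <= t -> W (g r)) ->
  exists2 e : R, 0 < e & forall r, s <= r <= t -> forall w,
     `|complex.Re w - complex.Re (g r)| < e ->
     `|complex.Im w - complex.Im (g r)| < e -> W w.
Proof.
move=> st solg openW gW.
apply: (interval_induction (P := fun u v => exists2 e : R, 0 < e &
  forall r, u <= r <= v -> forall w, `|complex.Re w - complex.Re (g r)| < e ->
     `|complex.Im w - complex.Im (g r)| < e -> W w)) => //.
  move=> u v w uv vw [e1 e10 H1] [e2 e20 H2].
  exists (Num.min e1 e2); first by rewrite lt_min e10.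
  move=> r /andP[ur rw] z; rewrite !lt_min => /andP[r1 r2] /andP[i1 i2].
  have [rv|vr] := leP r v; first by apply: (H1 r) => //; rewrite ur.
  by apply: (H2 r) => //; rewrite ltW.
move=> r rst; have [e e0 He] := openW _ (gW r rst).
have e20 : 0 < e / 2 by rewrite divr_gt0.
have [k k0 Hk] := solution_near r solg e20.
exists k => // u v _ _ ru ur rv vr; exists (e / 2) => // q /andP[uq qv] w wr wi.
have [|qr qi] := Hk q; first by rewrite ltr_norml; lra.
apply: He.
  have := ler_normD (complex.Re w - complex.Re (g q))
    (complex.Re (g q) - complex.Re (g r)).
  by rewrite addrA subrK; lra.
have := ler_normD (complex.Im w - complex.Im (g q))
  (complex.Im (g q) - complex.Im (g r)).
by rewrite addrA subrK; lra.
Qed.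

Lemma outside_open (R : realType) (x0 x1 : R) (z : R[i]) : outside x0 x1 z ->
  exists2 e : R, 0 < e & forall w, `|complex.Re w - complex.Re z| < e ->
    `|complex.Im w - complex.Im z| < e -> outside x0 x1 w.
Proof.
case: z => x y [/= h1 h2 h3].
pose S := `|x| + `|y| + 1.
have S0 : 0 < S by rewrite ltr_wpDl // addr_ge0.
(* From [q^2 >= p^2 - 2 |p| e1] in each coordinate, the squared modulus drops by less than its
   excess over 1. *)
pose e1 := (x ^+ 2 + y ^+ 2 - 1) / (2 * S).
have e10 : 0 < e1 by rewrite divr_gt0 ?subr_gt0 // mulr_gt0.
have line l xl : (y = l -> x < xl.1 \/ xl.2 < x) -> exists2 e : R, 0 < e &
    forall x' y', `|x' - x| < e -> `|y' - y| < e ->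
    y' = l -> x' < xl.1 \/ xl.2 < x'.
  move=> H; have [yl|yl] := eqVneq y l.
    have [xl1|xl2] := H yl.
      exists (xl.1 - x); first by rewrite subr_gt0.
      by move=> x' y'; rewrite ltr_norml => /andP[? ?] _ _; left; lra.
    exists (x - xl.2); first by rewrite subr_gt0.
    by move=> x' y'; rewrite ltr_norml => /andP[? ?] _ _; right; lra.
  exists `|y - l|; first by rewrite normr_gt0 subr_eq0.
  by move=> x' y' _ + y'l; rewrite y'l distrC ltxx.
have [e2 e20 H2] := line 1 (- x1, 0) h2.
have [e3 e30 H3] := line (-1) (0, x0) h3.
exists (Num.min e1 (Num.min e2 e3)); first by rewrite !lt_min e10 e20.
move=> [x' y'] /=; rewrite !lt_min => /and3P[r1 r2 r3] /and3P[i1 i2 i3].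
split => /=; [|exact: (H2 x' y')|exact: (H3 x' y')].
have e1E : e1 * (2 * S) = x ^+ 2 + y ^+ 2 - 1.
  by rewrite divfK // gt_eqF // mulr_gt0.
have bound p q : `|q - p| < e1 -> p ^+ 2 - 2 * (`|p| * e1) <= q ^+ 2.
  move=> qp; have : - (`|p| * e1) <= p * (q - p).
    apply: le_trans (lerNnormlW (lexx _)).
    by rewrite lerN2 normrM ler_wpM2l // ltW.
  have := sqr_ge0 (q - p).
  rewrite (_ : q ^+ 2 = p ^+ 2 + 2 * (p * (q - p)) + (q - p) ^+ 2); last by ring.
  lra.
have := bound _ _ r1; have := bound _ _ i1.
rewrite /S !mulrDr mulr1 in e1E; lra.
Qed.

Lemma reach_lower (R : realType) (a b c d x0 x1 : R) (g : R -> R[i]) (s : R) :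
  0 < b -> 0 < x1 -> filippov_solution (pws_field a b c d x0 x1) g ->
  [\/ 1 < complex.Im (g s),
      complex.Im (g s) = 1 /\ (complex.Re (g s) < - x1 \/ 0 < complex.Re (g s)) |
      [/\ -1 < complex.Im (g s) < 1, complex.Re (g s) < 0 &
          1 < complex.Re (g s) ^+ 2 + complex.Im (g s) ^+ 2]] ->
  exists s' x : R, 0 < x /\ - g s' = x +i* 1.
Proof.
move=> b0 x10 solg H.
have up : 1 < complex.Im (g s) \/ complex.Im (g s) = 1 /\ 0 < complex.Re (g s) ->
    exists s' x : R, 0 < x /\ - g s' = x +i* 1.
  move=> /(half_turn a c d x0 b0 x10)[tau [f [k [arcf f0 k0 fE _]]]].
  exists (s + tau), (x1 + k); split; first exact: addr_gt0.
  by rewrite (arc_track arcf solg) // ?lexx ?(ltW (arc_gt0 arcf)).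
have mid : complex.Im (g s) = 1 /\ complex.Re (g s) < - x1 \/
    [/\ -1 < complex.Im (g s) < 1, complex.Re (g s) < 0 &
        1 < complex.Re (g s) ^+ 2 + complex.Im (g s) ^+ 2] ->
    exists s' x : R, 0 < x /\ - g s' = x +i* 1.
  move=> hz; have [tau [f [arcf f0 fE]]] := middle_arc a c d x0 b0 x10 hz.
  exists (s + tau),
    (Num.sqrt (complex.Re (g s) ^+ 2 + complex.Im (g s) ^+ 2 - 1)); split.
    rewrite sqrtr_gt0 subr_gt0; case: hz => [[-> xneg]|[]//].
    suff : 0 < complex.Re (g s) ^+ 2 by lra.
    by rewrite -sqrrN exprn_gt0 // oppr_gt0; lra.
  rewrite (arc_track arcf solg) // ?lexx ?(ltW (arc_gt0 arcf)) // fE.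
  by apply: complex_eqP => /=; rewrite opprK.
case: H => [y1|[y1 [xneg|xpos]]|H]; first by apply: up; left.
- by apply: mid; left.
- by apply: up; right.
- by apply: mid; right.
Qed.

(** Every point of [outside] is, up to sign, a starting point of [reach_lower]: the upper region and
    the left of the strip directly, the lower region and the right of the strip after the symmetry.
    In the direct case a second application, to the opposite solution, ends on the section. *)
Lemma reach_section (R : realType) (a b c d x0 x1 : R) (g : R -> R[i]) (t : R) :
  0 < b -> 0 < d -> 0 < x0 -> 0 < x1 ->
  filippov_solution (pws_field a b c d x0 x1) g -> outside x0 x1 (g t) ->
  exists s x : R, 0 < x /\ g s = x +i* 1.
Proof.
move=> b0 d0 x00 x10 solg.
have solNg := pws_solutionN solg.
have lower s x : 0 < x -> - g s = x +i* 1 ->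
    exists s' x : R, 0 < x /\ g s' = x +i* 1.
  move=> xpos gs; have [|s' [x' [x'0 gs']]] := reach_lower (s := s) d0 x00 solNg.
    by rewrite gs; apply: Or32; split => //; right.
  by exists s', x'; rewrite -gs' opprK.
have ReN (w : R[i]) : complex.Re (- w) = - complex.Re w by case: w.
have ImN (w : R[i]) : complex.Im (- w) = - complex.Im w by case: w.
move=> [h1 h2 h3].
have [] : [\/ 1 < complex.Im (g t),
      complex.Im (g t) = 1 /\ (complex.Re (g t) < - x1 \/ 0 < complex.Re (g t)) |
      [/\ -1 < complex.Im (g t) < 1, complex.Re (g t) < 0 &
          1 < complex.Re (g t) ^+ 2 + complex.Im (g t) ^+ 2]] \/
   [\/ 1 < complex.Im (- g t),
      complex.Im (- g t) = 1 /\
        (complex.Re (- g t) < - x0 \/ 0 < complex.Re (- g t)) |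
      [/\ -1 < complex.Im (- g t) < 1, complex.Re (- g t) < 0 &
          1 < complex.Re (- g t) ^+ 2 + complex.Im (- g t) ^+ 2]].
- rewrite ReN ImN !sqrrN.
  have [y1|y1|y1] := ltgtP (complex.Im (g t)) 1; last first.
  + by left; apply: Or32; split => //; exact: h2.
  + by left; apply: Or31.
  have [y2|y2|y2] := ltgtP (-1) (complex.Im (g t)).
  + have [xn|xp|xE] := ltgtP (complex.Re (g t)) 0.
    * by left; apply: Or33; split => //; rewrite y2.
    * by right; apply: Or33; split => //; [apply/andP; split|]; lra.
    (* On the imaginary axis the open strip lies inside the unit disc. *)
    * move: h1; rewrite xE expr0n add0r /=.
      have : 0 < (1 - complex.Im (g t)) * (1 + complex.Im (g t)).
        by rewrite mulr_gt0 //; lra.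
      lra.
  + by right; apply: Or31; lra.
  + right; apply: Or32; split; first by rewrite -y2 opprK.
    by case: (h3 (esym y2)) => ?; [right|left]; lra.
- by move=> /(reach_lower b0 x10 solg)[s [x [xpos gs]]]; exact: lower xpos gs.
- move=> /(reach_lower d0 x00 solNg)[s [x [xpos gs]]].
  by exists s, x; rewrite -gs opprK.
Qed.

Lemma geometric_small (R : realType) (k C e : R) : 0 <= k -> k < 1 -> 0 < e ->
  exists n : nat, `|k ^+ n * C| < e.
Proof.
move=> k0 k1 e0.
have kn : `|k| < 1 by rewrite ger0_norm.
have /cvgrPdist_lt/(_ e e0)[n _ Hn] := cvg_geometric C kn.
exists n; have := Hn n (leqnn n).
by rewrite sub0r normrN /geometric /= mulrC.
Qed.

(** * The fixed point of the return map and the limit cycle *)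

Section limit_cycle.
Variables (R : realType) (a b c d x0 x1 : R).

Lemma return_map_affine (x y : R) :
  return_map a b c d x0 x1 x - return_map a b c d x0 x1 y =
  expR (c * (pi / d)) * expR (a * (pi / b)) * (x - y).
Proof. by rewrite /return_map; ring. Qed.

Lemma return_factor_lt1 : a < 0 -> c < 0 -> 0 < b -> 0 < d ->
  expR (c * (pi / d)) * expR (a * (pi / b)) < 1.
Proof.
move=> a0 c0 b0 d0; have pi0 := pi_gt0 R.
by rewrite mulr_ilt1 ?expR_ge0 // expR_lt1 nmulr_rlt0 // divr_gt0.
Qed.

Lemma return_map_fixpoint : 0 < x0 -> 0 < x1 ->
  expR (c * (pi / d)) * expR (a * (pi / b)) < 1 ->
  exists2 x, 0 < x & return_map a b c d x0 x1 x = x.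
Proof.
set k := _ * _ => x00 x10 k1; pose p := return_map a b c d x0 x1 0.
have k0 : 0 < 1 - k by rewrite subr_gt0.
have ea := expR_gt0 (a * (pi / b)); have ec := expR_gt0 (c * (pi / d)).
have p0 : 0 < p.
  by rewrite /p /return_map add0r !(addr_gt0, mulr_gt0).
(* The map is [x -> p + k x], with [p > 0] its value at 0. *)
exists (p / (1 - k)); first by rewrite divr_gt0.
have := return_map_affine (p / (1 - k)) 0; rewrite -/p -/k subr0.
move=> /eqP; rewrite subr_eq => /eqP ->.
by field; rewrite gt_eqF.
Qed.

Lemma return_map_gt0 (x : R) : 0 < x0 -> 0 < x1 -> 0 < x ->
  0 < return_map a b c d x0 x1 x.
Proof.
move=> x00 x10 xpos.
have ea := expR_gt0 (a * (pi / b)); have ec := expR_gt0 (c * (pi / d)).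
by rewrite /return_map !(addr_gt0, mulr_gt0).
Qed.

End limit_cycle.

Lemma solution_returns (R : realType) (a b c d x0 x1 p x s : R) (g : R -> R[i])
  (n : nat) :
  a < 0 -> c < 0 -> 0 < b -> 0 < d -> 0 < x0 -> 0 < x1 ->
  return_map a b c d x0 x1 p = p ->
  filippov_solution (pws_field a b c d x0 x1) g -> 0 < x -> g s = x +i* 1 ->
  exists s' x', [/\ 0 < x', g s' = x' +i* 1 &
    x' - p = (expR (c * (pi / d)) * expR (a * (pi / b))) ^+ n * (x - p)].
Proof.
move=> a0 c0 b0 d0 x00 x10 pfix solg xpos gs.
elim: n => [|n [s' [x' [x'0 gs' x'E]]]]; first by exists s, x; rewrite expr0 mul1r.
have [tau [f [arcf f0 fE]]] := full_turn a0 c0 b0 d0 x00 x10 x'0.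
exists (s' + tau), (return_map a b c d x0 x1 x'); split.
- exact: return_map_gt0.
- by rewrite (arc_track arcf solg) ?f0 // lexx ltW // (arc_gt0 arcf).
- by rewrite -[in LHS]pfix return_map_affine x'E exprS mulrA.
Qed.

(* The iterated returns of the solution tend to [p +i* 1] and the range of a
   periodic solution is compact, so the limit is itself on the orbit. *)
Lemma periodic_solution_hits (R : realType) (a b c d x0 x1 p x s T : R)
  (g : R -> R[i]) :
  a < 0 -> c < 0 -> 0 < b -> 0 < d -> 0 < x0 -> 0 < x1 ->
  return_map a b c d x0 x1 p = p ->
  filippov_solution (pws_field a b c d x0 x1) g ->
  0 < T -> (forall t, g (t + T) = g t) -> 0 < x -> g s = x +i* 1 ->
  exists t, g t = p +i* 1.
Proof.
move=> a0 c0 b0 d0 x00 x10 pfix solg T0 gT xpos gs; apply: contrapT => ngp.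
(* If the orbit missed the point, a whole tube around one period would miss it; a return closer than
   [e] contradicts this. *)
have [||e e0 He] := @solution_tube _ _ g [set z | z <> p +i* 1] 0 T (ltW T0) solg.
- case=> u v /= zp; have [up|up] := eqVneq u p.
    have [v1|v1] := eqVneq v 1; first by case: zp; rewrite up v1.
    exists `|v - 1|; first by rewrite normr_gt0 subr_eq0.
    by case=> u' v' /= _ + [_ v'E]; rewrite v'E distrC ltxx.
  exists `|u - p|; first by rewrite normr_gt0 subr_eq0.
  by case=> u' v' /= + _ [u'E _]; rewrite u'E distrC ltxx.
- by move=> r _ gr; apply: ngp; exists r.
have k0 : 0 <= expR (c * (pi / d)) * expR (a * (pi / b)).
  by rewrite mulr_ge0 ?expR_ge0.
have k1 := return_factor_lt1 a0 c0 b0 d0.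
have [n Hn] := geometric_small (x - p) k0 k1 e0.
have [s' [x' [x'0 gs' x'E]]] :=
  solution_returns n a0 c0 b0 d0 x00 x10 pfix solg xpos gs.
have [r rT gr] := periodic_reduce gT s' T0.
apply: (He r rT (p +i* 1)) => //=; rewrite gr gs' /= ?subrr ?normr0 //.
by rewrite distrC x'E.
Qed.

Lemma norm_lt_Re_Im (R : realType) (u v : R[i]) (e : R) : `|u - v| < e%:C ->
  `|complex.Re u - complex.Re v| < e /\ `|complex.Im u - complex.Im v| < e.
Proof.
case: u v => [x y] [x' y'] uv.
have e0 : 0 < e by have := le_lt_trans (normr_ge0 _) uv; rewrite ltcR.
have : (x - x') ^+ 2 + (y - y') ^+ 2 < e ^+ 2.
  rewrite -ltcR [X in X < _](add_Re2_Im2 ((x +i* y) - (x' +i* y'))) rmorphXn /=.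
  by rewrite ltr_pXn2r ?nnegrE ?normr_ge0 // lecR ltW.
have sqr_lt (q : R) : q ^+ 2 < e ^+ 2 -> `|q| < e.
  by rewrite -(real_normK (num_real q)) ltr_sqr ?nnegrE // ltW.
have := sqr_ge0 (x - x'); have := sqr_ge0 (y - y') => /= ? ? H.
by split; apply: sqr_lt; lra.
Qed.

Theorem proposition2 (R : realType) (a b c d x0 x1 : R)
    (ha : a < 0) (hc : c < 0) (hb : 0 < b) (hd : 0 < d)
    (hx0 : 0 < x0) (hx1 : 0 < x1) :
  exists G : set R[i],
    limit_cycle
      (filippov_field
         (fun z : R[i] => (a +i* b) * (z - 'i%C + x1%:C))
         (fun z : R[i] => 'i%C * z)
         (fun z : R[i] => (c +i* d) * (z + 'i%C - x0%:C)))
      G.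
Proof.
rewrite -/(pws_field a b c d x0 x1).
have k1 := return_factor_lt1 ha hc hb hd.
have [p p0 pfix] := return_map_fixpoint hx0 hx1 k1.
have [tau [f [arcf f0 fE]]] := full_turn ha hc hb hd hx0 hx1 p0.
have ftau : f tau = f 0 by rewrite fE f0 pfix.
have tau0 := arc_gt0 arcf.
pose h := periodic_ext f tau.
have hper t : h (t + tau) = h t by exact: periodic_extP.
have solh : filippov_solution (pws_field a b c d x0 x1) h.
  exact: closed_arc_solution arcf ftau.
have h0 : h 0 = p +i* 1.
  by rewrite /h /periodic_ext mul0r floor0 mul0r subr0.
exists (range h); split.
  exists h; split => //; first by exists tau.
  (* Non-constancy: just after time 0 the solution is strictly above the line on which it starts. *)
  have [|||e e0 He] := @solution_cross R a b c d x0 x1 1 h 0 hb (expr1n _ _) solh.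
  - by rewrite h0.
  - by rewrite h0 mul1r.
  - by rewrite h0 mul1r addr_gt0.
  exists 0, (0 + e / 2) => hE.
  have [|_] := He (e / 2); first by apply/andP; split; lra.
  by rewrite -hE h0 /= subrr mulr0 ltxx.
have outh t : outside x0 x1 (h t).
  have [r rt <-] := periodic_reduce hper t tau0.
  rewrite /h (periodic_ext_piece tau0 ftau (n := 0)) ?mul0r ?add0r ?mul1r //.
  by rewrite subr0; exact: (arc_in arcf).
(* The radius of this tube is the isolation radius: a periodic orbit coming that close has a point
   in [outside]. *)
have [e e0 He] := solution_tube (ltW tau0) solh
  (@outside_open R x0 x1) (fun r _ => outh r).
exists e => // G' [g [solg [T T0 gT] _ ->]] [z [w [[t _ <-] [t' _ <-] zw]]].
have [r rt hr] := periodic_reduce hper t tau0.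
have outg : outside x0 x1 (g t').
  have [Hr Hi] := norm_lt_Re_Im zw; rewrite -hr in Hr Hi.
  exact: (He r rt).
have [s [x [xpos gs]]] := reach_section hb hd hx0 hx1 solg outg.
have [q gq] := periodic_solution_hits ha hc hb hd hx0 hx1 pfix solg T0 gT xpos gs.
have track v : 0 <= v -> g (q + v) = h v.
  by apply: (closed_arc_track arcf ftau solg); rewrite gq f0.
apply/seteqP; split => _ [v _ <-].
  (* Agreement with the cycle is known only after time [q]; adding enough periods moves [v] beyond
     it. *)
  have [m /andP[_ m2]] := periodic_ext_right T0 (q - v).
  rewrite -(periodic_shift gT (m + 1) v).
  have v'q : 0 <= v + (m + 1)%:~R * T - q by lra.
  by exists (v + (m + 1)%:~R * T - q); rewrite // -track // addrC subrK.
have [v' /andP[v'0 _] <-] := periodic_reduce hper v tau0.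
by exists (q + v'); rewrite // track.
Qed.
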